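(* Consider an electrical circuit, modeled as described in the context, that contains no VC-loop and no IL-cutset. Assume that the incremental memristance matrix $M$, resistance matrix $R$, memductance matrix $W$ and conductance matrix $G$ are positive definite (at every point). Then the order of complexity of the circuit equals the total number of $q$-memristors, $\varphi$-memristors, capacitors and inductors.
   Context: Circuit setting. The circuit has an underlying directed graph (digraph) $\mathcal{G}$ with $n$ nodes, $m$ branches and $k$ connected components. A cutset is a set of branches whose removal increases the number of connected components and which is minimal with this property; a loop is a (closed) cycle of branches. Let $B\in\mathbb{R}^{(m-n+k)\times m}$ be a reduced loop matrix (a full-row-rank set of rows of the loop matrix, whose entry $(i,j)$ is $1$, $-1$ or $0$ according as branch $j$ is in loop $i$ with the same orientation, the opposite orientation, or not at all) and $D\in\mathbb{R}^{(n-k)\times m}$ a reduced cutset matrix (defined analogously with oriented cutsets), with columns in the same branch order. For a set of branches $K$, $B_K$, $D_K$ denote the submatrices formed by the columns of branches in $K$. Each branch carries a voltage $v$ and a current $i$ and belongs to exactly one of eight classes. The $q$-devices satisfy $v=\eta(q,i,t)$ with $\eta$ of class $C^1$: $q$-memristors ($v_m=\eta_1(q_m,i_m,t)$, with $\partial\eta_1/\partial q_m\not\equiv0$, $\partial\eta_1/\partial i_m\not\equiv 0$), capacitors ($v_c=\eta_2(q_c,t)$), current-controlled resistors ($v_r=\eta_3(i_r,t)$) and independent voltage sources ($v_u=\eta_4(t)$). The $\varphi$-devices satisfy $i=\zeta(\varphi,v,t)$ with $\zeta$ of class $C^1$: $\varphi$-memristors ($i_w=\zeta_1(\varphi_w,v_w,t)$,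 with $\partial\zeta_1/\partial\varphi_w\not\equiv0$, $\partial\zeta_1/\partial v_w\not\equiv0$), inductors ($i_l=\zeta_2(\varphi_l,t)$), voltage-controlled resistors ($i_g=\zeta_3(v_g,t)$) and independent current sources ($i_j=\zeta_4(t)$). The maps $\eta_k,\zeta_k$ may be vector-valued (coupling allowed). Writing $B=(B_q\ B_\varphi)$, $D=(D_q\ D_\varphi)$ according to $q$- and $\varphi$-devices, the circuit dynamics is the differential-algebraic system $q_m'=i_m,\ q_c'=i_c,\ \varphi_w'=v_w,\ \varphi_l'=v_l$, together with the device relations above, and Kirchhoff's laws $B_qv_q+B_\varphi v_\varphi=0$, $D_qi_q+D_\varphi i_\varphi=0$. Characteristic matrices: memristance $M=\partial\eta_1/\partial i_m$, resistance $R=\partial\eta_3/\partial i_r$, memductance $W=\partial\zeta_1/\partial v_w$, conductance $G=\partial\zeta_3/\partial v_g$. A square matrix $P$ is positive definite if $u^TPu>0$ for all $u\neq0$ (symmetry not assumed). A VC-loop is a loop consisting only of voltage sources and/or capacitors; an IL-cutset is a cutset consisting only of current sources and/or inductors. The order of complexity (state dimension) of the circuit is the number of variables that can be freely assigned an initial value in this model. *)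

(* Defs.v *)
From HB Require Import structures.
From mathcomp Require Import all_boot all_order all_algebra.
From mathcomp Require Import all_classical all_reals all_analysis.
Set Implicit Arguments. Unset Strict Implicit. Unset Printing Implicit Defensive.
Import Order.TTheory GRing.Theory Num.Theory.
Local Open Scope ring_scope.

(* Underlying digraph: n nodes 'I_n, m branches 'I_m, branch j goes    *)
(* from node tl j to node hd j.                                        *)

Definition gadj (n m : nat) (tl hd : 'I_m -> 'I_n) (K : {set 'I_m}) : rel 'I_n :=
  fun x y => [exists j in K, ((tl j == x) && (hd j == y)) || ((tl j == y) && (hd j == x))].

Definition ncomp (n m : nat) (tl hd : 'I_m -> 'I_n) (K : {set 'I_m}) : nat :=
  n_comp (gadj tl hd K) predT.

Definition is_cutset (n m : nat) (tl hd : 'I_m -> 'I_n) (K : {set 'I_m}) : Prop :=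
  (ncomp tl hd [set: 'I_m] < ncomp tl hd (~: K))%N /\
  forall K' : {set 'I_m}, K' \proper K -> (ncomp tl hd (~: K') <= ncomp tl hd [set: 'I_m])%N.

Definition deg (n m : nat) (tl hd : 'I_m -> 'I_n) (L : {set 'I_m}) (x : 'I_n) : nat :=
  (\sum_(j in L) ((tl j == x) + (hd j == x)))%N.

Definition even_set (n m : nat) (tl hd : 'I_m -> 'I_n) (L : {set 'I_m}) : Prop :=
  forall x, ~~ odd (deg tl hd L x).

(* loop (closed cycle of branches) = minimal nonempty set of branches in
   which every node has even degree *)
Definition is_loop (n m : nat) (tl hd : 'I_m -> 'I_n) (L : {set 'I_m}) : Prop :=
  L != (finset.set0 : {set 'I_m}) /\ even_set tl hd L /\
  forall L' : {set 'I_m}, L' \proper L -> L' != (finset.set0 : {set 'I_m}) -> ~ even_set tl hd L'.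

(* a row of the loop matrix: an oriented loop (entries +-1 on the loop
   according to a traversal direction, 0 elsewhere) *)
Definition loop_row (R : ringType) (n m : nat) (tl hd : 'I_m -> 'I_n) (b : 'rV[R]_m) : Prop :=
  exists L : {set 'I_m}, [/\ is_loop tl hd L,
    (forall j, j \in L -> b ord0 j = 1 \/ b ord0 j = -1),
    (forall j, j \notin L -> b ord0 j = 0) &
    (forall x : 'I_n, \sum_(j < m) b ord0 j * ((hd j == x)%:R - (tl j == x)%:R) = 0)].

Definition cutset_row (R : ringType) (n m : nat) (tl hd : 'I_m -> 'I_n) (b : 'rV[R]_m) : Prop :=
  exists (K : {set 'I_m}) (S : {set 'I_n}), [/\ is_cutset tl hd K,
    (forall j, (j \in K) = ((tl j \in S) != (hd j \in S))) &
    (forall j, b ord0 j = if j \in K then (if tl j \in S then 1 else -1) else 0)].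

Definition reduced_loop_matrix (R : fieldType) (n m : nat) (tl hd : 'I_m -> 'I_n)
    (r : nat) (B : 'M[R]_(r, m)) : Prop :=
  [/\ r = (m + ncomp tl hd [set: 'I_m] - n)%N, \rank B = r & forall i, loop_row tl hd (row i B)].

Definition reduced_cutset_matrix (R : fieldType) (n m : nat) (tl hd : 'I_m -> 'I_n)
    (r : nat) (D : 'M[R]_(r, m)) : Prop :=
  [/\ r = (n - ncomp tl hd [set: 'I_m])%N, \rank D = r & forall i, cutset_row tl hd (row i D)].

Inductive dclass :=
  | QMem
  | Cap
  | CRes   (* current-controlled resistor *)
  | VSrc
  | PMem   (* phi-memristor *)
  | Ind
  | VRes   (* voltage-controlled resistor *)
  | CSrc.

Definition dclass_eqb (a b : dclass) : bool :=
  match a, b with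
  | QMem, QMem | Cap, Cap | CRes, CRes | VSrc, VSrc
  | PMem, PMem | Ind, Ind | VRes, VRes | CSrc, CSrc => true
  | _, _ => false
  end.

Lemma dclass_eqP : Equality.axiom dclass_eqb.
Proof. by case; case; constructor. Qed.
HB.instance Definition _ := hasDecEq.Build dclass dclass_eqP.

Definition dynamic (c : dclass) : bool :=
  match c with QMem | Cap | PMem | Ind => true | _ => false end.

(* Device relations.  All vectors are indexed by the whole branch set *)
(* 'I_m; a device map of class c is only read at the branches of class *)
(* c, and must depend only on the arguments at branches of class c     *)
(* (coupling is allowed only within a class).  Extra coordinates are   *)
(* irrelevant padding.                                                 *)
Record devices (R : realType) (m : nat) := Devices {
  eta1 : 'rV[R]_m -> 'rV[R]_m -> R -> 'rV[R]_m;  (* v_m = eta1(q_m, i_m, t) *)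
  eta2 : 'rV[R]_m -> R -> 'rV[R]_m;              (* v_c = eta2(q_c, t) *)
  eta3 : 'rV[R]_m -> R -> 'rV[R]_m;              (* v_r = eta3(i_r, t) *)
  eta4 : R -> 'rV[R]_m;                          (* v_u = eta4(t) *)
  zeta1 : 'rV[R]_m -> 'rV[R]_m -> R -> 'rV[R]_m; (* i_w = zeta1(phi_w, v_w, t) *)
  zeta2 : 'rV[R]_m -> R -> 'rV[R]_m;             (* i_l = zeta2(phi_l, t) *)
  zeta3 : 'rV[R]_m -> R -> 'rV[R]_m;             (* i_g = zeta3(v_g, t) *)
  zeta4 : R -> 'rV[R]_m                          (* i_j = zeta4(t) *)
}.

Definition agree_on (R : Type) (m : nat) (cls : 'I_m -> dclass) (c : dclass)
    (x y : 'rV[R]_m) : Prop :=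
  forall k, cls k = c -> x ord0 k = y ord0 k.

Definition local1 (R : realType) (m : nat) (cls : 'I_m -> dclass) (c : dclass)
    (f : 'rV[R]_m -> R -> 'rV[R]_m) : Prop :=
  forall x x' t, agree_on cls c x x' -> agree_on cls c (f x t) (f x' t).

Definition local2 (R : realType) (m : nat) (cls : 'I_m -> dclass) (c : dclass)
    (f : 'rV[R]_m -> 'rV[R]_m -> R -> 'rV[R]_m) : Prop :=
  forall x x' y y' t, agree_on cls c x x' -> agree_on cls c y y' ->
    agree_on cls c (f x y t) (f x' y' t).

(* class C^1 (on finite-dimensional normed spaces: differentiable everywhere
   with continuous directional derivatives x |-> D_u f x) *)
Definition C1 (R : realType) (V W : normedModType R) (f : V -> W) : Prop :=
  (forall x, differentiable f x) /\ (forall u, continuous (fun x => 'D_u f x)).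

Definition devices_C1 (R : realType) (m : nat) (dv : devices R m) : Prop :=
  C1 (fun p : 'rV[R]_m * 'rV[R]_m * R => eta1 dv p.1.1 p.1.2 p.2) /\
      C1 (fun p : 'rV[R]_m * R => eta2 dv p.1 p.2) /\
      C1 (fun p : 'rV[R]_m * R => eta3 dv p.1 p.2) /\
      C1 (eta4 dv) /\
      C1 (fun p : 'rV[R]_m * 'rV[R]_m * R => zeta1 dv p.1.1 p.1.2 p.2) /\
      C1 (fun p : 'rV[R]_m * R => zeta2 dv p.1 p.2) /\
      C1 (fun p : 'rV[R]_m * R => zeta3 dv p.1 p.2) /\
      C1 (zeta4 dv).

Definition devices_local (R : realType) (m : nat) (cls : 'I_m -> dclass)
    (dv : devices R m) : Prop :=
  local2 cls QMem (eta1 dv) /\ local1 cls Cap (eta2 dv) /\ local1 cls CRes (eta3 dv) /\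
      local2 cls PMem (zeta1 dv) /\ local1 cls Ind (zeta2 dv) /\ local1 cls VRes (zeta3 dv).

Definition supp_in (R : ringType) (m : nat) (cls : 'I_m -> dclass) (c : dclass)
    (u : 'rV[R]_m) : Prop :=
  forall k, cls k != c -> u ord0 k = 0.

(* The (incremental) matrix P = the derivative L restricted to the class-c
   block is positive definite (not necessarily symmetric): u^T P u > 0 for
   all nonzero u. *)
Definition posdef_on (R : realType) (m : nat) (cls : 'I_m -> dclass) (c : dclass)
    (L : 'rV[R]_m -> 'rV[R]_m) : Prop :=
  forall u : 'rV[R]_m, supp_in cls c u -> u != 0 ->
    0 < \sum_(k < m | cls k == c) u ord0 k * L u ord0 k.

Definition nonzero_block (R : realType) (m : nat) (cls : 'I_m -> dclass) (c : dclass)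
    (L : 'rV[R]_m -> 'rV[R]_m) : Prop :=
  exists u : 'rV[R]_m, supp_in cls c u /\ exists k, cls k = c /\ L u ord0 k != 0.

Definition memristor_model (R : realType) (m : nat) (cls : 'I_m -> dclass)
    (dv : devices R m) : Prop :=
  [/\ (exists k, cls k = QMem) ->
        exists q i t, nonzero_block cls QMem ('d (fun q' => eta1 dv q' i t) q),
      (exists k, cls k = QMem) ->
        exists q i t, nonzero_block cls QMem ('d (fun i' => eta1 dv q i' t) i),
      (exists k, cls k = PMem) ->
        exists p v t, nonzero_block cls PMem ('d (fun p' => zeta1 dv p' v t) p) &
      (exists k, cls k = PMem) ->
        exists p v t, nonzero_block cls PMem ('d (fun v' => zeta1 dv p v' t) v)].

(* The circuit DAE.  A point of the variable space is a triple        *)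
(* (z, v, i) : z j is the charge q_j (for q-memristors and capacitors) *)
(* or the flux phi_j (for phi-memristors and inductors), unused for    *)
(* other branches; v, i are the branch voltages and currents.          *)
Definition cstate (R : Type) (m : nat) := ('rV[R]_m * 'rV[R]_m * 'rV[R]_m)%type.

(* circuit variables: (0, j) = z_j (only for dynamic branches),
   (1, j) = v_j, (2, j) = i_j *)
Definition cvar (m : nat) := ('I_3 * 'I_m)%type.

Definition valid_var (m : nat) (cls : 'I_m -> dclass) (x : cvar m) : bool :=
  (x.1 != 0 :> nat) || dynamic (cls x.2).

Definition var_val (R : Type) (m : nat) (s : cstate R m) (x : cvar m) : R :=
  if x.1 == 0 :> nat then s.1.1 ord0 x.2
  else if x.1 == 1 :> nat then s.1.2 ord0 x.2
  else s.2 ord0 x.2.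

Definition consistent (R : realType) (m rB rD : nat) (cls : 'I_m -> dclass)
    (B : 'M[R]_(rB, m)) (D : 'M[R]_(rD, m)) (dv : devices R m)
    (t : R) (s : cstate R m) : Prop :=
  let z := s.1.1 in let v := s.1.2 in let i := s.2 in
  (forall j, match cls j with
   | QMem => v ord0 j = eta1 dv z i t ord0 j
   | Cap  => v ord0 j = eta2 dv z t ord0 j
   | CRes => v ord0 j = eta3 dv i t ord0 j
   | VSrc => v ord0 j = eta4 dv t ord0 j
   | PMem => i ord0 j = zeta1 dv z v t ord0 j
   | Ind  => i ord0 j = zeta2 dv z t ord0 j
   | VRes => i ord0 j = zeta3 dv v t ord0 j
   | CSrc => i ord0 j = zeta4 dv t ord0 j
   end) /\ B *m v^T = 0 /\ D *m i^T = 0.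

Definition is_solution (R : realType) (m rB rD : nat) (cls : 'I_m -> dclass)
    (B : 'M[R]_(rB, m)) (D : 'M[R]_(rD, m)) (dv : devices R m)
    (a b : R) (sol : R -> cstate R m) : Prop :=
  forall t, a < t < b ->
    consistent cls B D dv t (sol t) /\
    forall j, dynamic (cls j) ->
      is_derive t 1 (fun s => (sol s).1.1 ord0 j)
        (if (cls j == QMem) || (cls j == Cap) then (sol t).2 ord0 j
         else (sol t).1.2 ord0 j).

(* Order of complexity = k : near every consistent point p (at any time t0)
   there is a set J of k circuit variables which can be freely assigned an
   initial value (every assignment of values close to those of p is the
   initial value at t0 of some solution), and which determines the whole
   initial state (two consistent points near p which agree on J agree on
   all circuit variables). *)
Definition order_of_complexity (R : realType) (m rB rD : nat) (cls : 'I_m -> dclass)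
    (B : 'M[R]_(rB, m)) (D : 'M[R]_(rD, m)) (dv : devices R m) (k : nat) : Prop :=
  forall (t0 : R) (p : cstate R m), consistent cls B D dv t0 p ->
  exists (J : {set cvar m}) (eps : R), [/\ J \subset valid_var cls, #|J| = k, 0 < eps,
    (forall a : cvar m -> R, (forall x, x \in J -> `|a x - var_val p x| < eps) ->
       exists (d : R) (sol : R -> cstate R m), 0 < d /\
         is_solution cls B D dv (t0 - d) (t0 + d) sol /\
         forall x, x \in J -> var_val (sol t0) x = a x) &
    (forall s1 s2 : cstate R m,
       consistent cls B D dv t0 s1 -> consistent cls B D dv t0 s2 ->
       (forall x, valid_var cls x -> `|var_val s1 x - var_val p x| < eps) ->
       (forall x, valid_var cls x -> `|var_val s2 x - var_val p x| < eps) ->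
       (forall x, x \in J -> var_val s1 x = var_val s2 x) ->
       forall x, valid_var cls x -> var_val s1 x = var_val s2 x)].

(* Main.v *)
Require Import Defs.
From HB Require Import structures.
From mathcomp Require Import all_boot all_order all_algebra.
From mathcomp Require Import all_classical all_reals all_analysis.
From mathcomp Require Import ring lra.
Import Order.TTheory GRing.Theory Num.Theory.
Import numFieldNormedType.Exports.
Local Open Scope ring_scope.

(* The charges and fluxes [z] of the dynamic branches serve as free variables.
   Let [u] collect the currents of the q-devices and the voltages of the
   phi-devices, and [o] the remaining branch variables, so that the devices read
   [o = h(z, u, t)].  By Tellegen's theorem [sum u o = 0] for any pair satisfying
   Kirchhoff's laws; positive definiteness makes [h] strictly monotone in the
   resistive components of [u], and the topological assumptions dispose of the
   capacitors, inductors and sources.  Hence [(z, t)] determines all voltages and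
   currents (globally, by the mean value theorem), and the linearization in
   [(v, i)] is invertible, so that they are locally a Lipschitz function of
   [(z, t)].  Since [z' = u], Picard iteration yields a solution through every
   nearby [z]. *)

(** * Loops, cutsets and Kirchhoff's laws *)

(** Uniqueness of the state and invertibility of the linearization are one statement,
    [circuit_zero], read twice: for the difference of two states and for a kernel vector of the
    Jacobian. The topological assumptions enter through supports. The support of a nonzero
    circulation contains a loop, that of a nonzero coboundary contains a cutset, so whatever current
    or voltage survives Tellegen's argument would exhibit a VC-loop or an IL-cutset. The algebraic
    system is square because the row spaces of [B] and [D] are orthogonal and their ranks add up to
    [m]. [C1] only provides continuous directional derivatives, whereas the Newton map needs an
    increment estimate uniform over two moving points; strict derivatives bridge this gap. The
    implicit function and the Picard iteration then both come from one fixed point theorem for the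
    sup distance. *)

(** Orthogonality gives one inclusion and the rank bound leaves no room for it to be strict. Applied
    to loop and cutset matrices, this turns Kirchhoff's laws into the parametrizations [i = b *m B]
    and [v = b *m D]. *)
Lemma kermx_tr_eqmx (F : fieldType) p q m (B : 'M[F]_(p, m)) (D : 'M[F]_(q, m)) :
  B *m D^T = 0 -> (m <= \rank B + \rank D)%N -> (kermx D^T :=: B)%MS.
Proof.
move=> BD rBD; have sBk : (B <= kermx D^T)%MS by apply/sub_kermxP.
apply/eqmxP/andP; split=> //.
by rewrite -(geq_leqif (mxrank_leqif_sup sBk)) mxrank_ker mxrank_tr leq_subLR addnC.
Qed.

Section Graph.
Context {n m : nat} (tl hd : 'I_m -> 'I_n).

(** Handshake lemma; a branch with equal ends counts twice at its node. *)
Lemma sum_deg (L : {set 'I_m}) : (\sum_x deg tl hd L x = #|L|.*2)%N.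
Proof.
rewrite /deg exchange_big /= -addnn -sum1_card -big_split /=.
have one (y : 'I_n) : (\sum_x (y == x) = 1)%N.
  by rewrite (bigD1 y) //= eqxx big1 // => x /negPf; rewrite eq_sym => ->.
by apply: eq_bigr => j _; rewrite big_split /= !one.
Qed.

(* A forest with an edge has a leaf.  Counting degrees, a set without leaves has
   at least as many branches as it meets nodes, while the mod 2 boundary map
   takes values in the sum-zero hyperplane, so it has a nontrivial kernel. *)
Lemma leafless_even_subset (K : {set 'I_m}) :
  K != (finset.set0 : {set 'I_m}) -> (forall x, deg tl hd K x != 1%N) ->
  exists L : {set 'I_m}, [/\ L \subset K, L != (finset.set0 : {set 'I_m})
                           & even_set tl hd L].
Proof.
move=> /set0Pn [j0 j0K] noleaf.
pose V := [set x | deg tl hd K x != 0%N].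
have deg_sub (L : {set 'I_m}) x : L \subset K -> x \notin V -> deg tl hd L x = 0%N.
  rewrite inE negbK /deg sum_nat_eq0 => /fintype.subsetP LK /forallP K0.
  by apply: big1 => j /LK jK; apply/eqP; have := K0 j; rewrite jK.
have x0V : tl j0 \in V by rewrite inE /deg (bigD1 j0) //= eqxx.
set x0 := tl j0 in x0V.
have cardV : (#|V| <= #|K|)%N.
  rewrite -leq_double -sum_deg (bigID (mem V)) /= -sum1_card -muln2 big_distrl /=.
  apply: leq_trans (leq_addr _ _); apply: leq_sum => x.
  by rewrite inE; move: (noleaf x); case: deg => [|[]].
(* Incidence matrix mod 2 without the column of [x0]: by [cardV] it has more rows than columns, and
   the support of a left kernel vector is the set [L]. *)
pose N : 'M['F_2]_(#|K|, #|V :\ x0|) := \matrix_(a, b)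
  ((tl (enum_val a) == enum_val b) + (hd (enum_val a) == enum_val b))%:R.
have /rowV0Pn [w wN wn0] : kermx N != 0.
  rewrite kermx_eq0 /row_free neq_ltn; apply/orP; left.
  by apply: leq_ltn_trans (rank_leq_col _) _; rewrite (cardsD1 x0) x0V in cardV.
have {}wN : w *m N = 0 by apply/sub_kermxP.
pose L := [set enum_val a | a in [pred a | w ord0 a != 0]].
have LK : L \subset K.
  by apply/fintype.subsetP => _ /imsetP [a _ ->]; apply: enum_valP.
have F2_neq0 (a : 'F_2) : a != 0 -> a = 1.
  by case: a => [[|[|k]] i] //= _; apply/val_inj.
have evenV x : x != x0 -> ~~ odd (deg tl hd L x).
  move=> xx0; have [xV|/(deg_sub _ _ LK)-> //] := boolP (x \in V).
  have xV' : x \in V :\ x0 by rewrite in_setD1 xx0.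
  have /matrixP /(_ ord0 (enum_rank_in xV' x)) := wN.
  rewrite !mxE => s0.
  have : (deg tl hd L x)%:R = 0 :> 'F_2.
    rewrite -[RHS]s0 /deg big_imset /=; last by move=> ? ? _ _; apply: enum_val_inj.
    rewrite natr_sum [RHS](bigID [pred a | w ord0 a != 0]) /=.
    rewrite [X in _ = _ + X]big1 ?addr0; last by move=> a /negPn/eqP->; rewrite mul0r.
    apply: eq_bigr => a wa; rewrite !mxE enum_rankK_in //.
    by rewrite (F2_neq0 _ wa) mul1r.
  move/eqP; rewrite -(dvdn_pcharf (pchar_Fp (isT : prime 2))) //.
  by rewrite dvdn2.
exists L; split=> // [|x].
  have [a wa] : exists a, w ord0 a != 0.
    apply/existsP; apply: contraNT wn0; rewrite negb_exists => /forallP w0.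
    by apply/eqP/rowP => a; rewrite mxE; apply/eqP; rewrite -[_ == _]negbK.
  by apply/set0Pn; exists (enum_val a); apply: imset_f.
(* The dropped column gives no equation at [x0]; the handshake lemma recovers the parity there, all
   other degrees being even. *)
have [->|/evenV //] := eqVneq x x0.
have := congr1 odd (sum_deg L); rewrite odd_double (bigD1 x0) //= oddD.
suff -> : odd (\sum_(i | i != x0) deg tl hd L i) = false by rewrite addbF => ->.
apply: negPf; apply: (@big_ind _ (fun a => ~~ odd a)) => // a b.
by rewrite oddD => /negPf-> /negPf->.
Qed.

Lemma even_set_loop (K : {set 'I_m}) :
  K != (finset.set0 : {set 'I_m}) -> even_set tl hd K ->
  exists2 L : {set 'I_m}, L \subset K & is_loop tl hd L.
Proof.
move=> K0 Kev.
pose P (L : {set 'I_m}) := (L != (finset.set0 : {set 'I_m})) && [forall x, ~~ odd (deg tl hd L x)].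
have /minset_exists [L /minsetP [/andP [L0 /forallP Lev] Lmin] LK] : P K.
  by rewrite /P K0; apply/forallP.
exists L => //; split=> //; split=> // L' /properP [sL' [j jL jL']] L'0 L'ev.
have E : L' = L by apply: Lmin => //; rewrite /P L'0; apply/forallP.
by rewrite E jL in jL'.
Qed.

Definition circulation (R : pzRingType) (b : 'rV[R]_m) : Prop :=
  forall x : 'I_n, \sum_(j < m) b ord0 j * ((hd j == x)%:R - (tl j == x)%:R) = 0.

(** The support has no leaf: at a node of degree 1 the conservation law reduces to a single nonzero
    term. A leafless set contains a nonempty even set, and a minimal one is a loop. *)
Lemma circulation_loop (R : pzRingType) (b : 'rV[R]_m) :
  circulation R b -> b != 0 ->
  exists2 L, is_loop tl hd L & forall j, j \in L -> b ord0 j != 0.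
Proof.
move=> bcirc bn0; pose K := [set j | b ord0 j != 0].
have K0 : K != (finset.set0 : {set 'I_m}).
  apply: contra bn0 => /eqP K0; apply/eqP/rowP => j; rewrite mxE.
  by apply/eqP; rewrite -[_ == _]negbK; have := finset.in_set0 j; rewrite -K0 inE => ->.
have noleaf x : deg tl hd K x != 1%N.
  apply/eqP => degx.
  have /existsP [j /andP [jK jx]] :
      [exists j, (j \in K) && ((tl j == x) + (hd j == x) != 0)%N].
    apply: contra_eqT degx; rewrite negb_exists => /forallP x0.
    by rewrite /deg big1 // => j jK; apply/eqP; have := x0 j; rewrite jK negbK.
  move: degx; rewrite /deg (bigD1 j) //= => degx.
  have [dj dK] : ((tl j == x) + (hd j == x) = 1)%N /\
      (\sum_(i in K | i != j) ((tl i == x) + (hd i == x)) = 0)%N.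
    by move: degx jx; case: (tl j == x); case: (hd j == x) => //=; rewrite ?add1n => -[].
  have := bcirc x; rewrite (bigD1 j) //= [X in _ + X]big1 => [|i ij].
    rewrite addr0 => bj; move: jK; rewrite inE => /negP; apply; move: bj dj.
    case: (tl j == x); case: (hd j == x) => //= + _; rewrite ?subr0 ?sub0r ?mulr1 //.
      by rewrite mulrN1 => /eqP; rewrite oppr_eq0.
    by move=> ->.
  have [iK|] := boolP (i \in K); last by rewrite inE negbK => /eqP->; rewrite mul0r.
  move: dK => /eqP; rewrite sum_nat_eq0 => /forallP/(_ i); rewrite iK ij /=.
  by case: (tl i == x); case: (hd i == x) => //=; rewrite subrr mulr0.
have [K' [sK' K'0 K'ev]] := leafless_even_subset _ K0 noleaf.
have [L sL Lloop] := even_set_loop _ K'0 K'ev.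
exists L => // j jL.
by have := fintype.subsetP (fintype.subset_trans sL sK') _ jL; rewrite inE.
Qed.

Lemma gadj_connect_sym (K : {set 'I_m}) : connect_sym (gadj tl hd K).
Proof.
by apply: sym_connect_sym => x y; apply: eq_existsb => j; rewrite orbC.
Qed.

End Graph.

(** Mapping the root of an [e']-class to its [e]-root is injective. It is not onto, for otherwise
    every node would be [e]-connected to the root of its [e']-class, and [e] would connect [x] to
    [y]. *)
Lemma n_comp_lt (T : finType) (e e' : rel T) (x y : T) :
  connect_sym e -> connect_sym e' -> subrel e e' ->
  connect e' x y -> ~~ connect e x y -> (n_comp e' predT < n_comp e predT)%N.
Proof.
move=> se se' ee' e'xy exy.
have cee' : subrel (connect e) (connect e').
  by apply: connect_sub => a b /ee'; apply: connect1.
set A := [set r | roots e r]; set A' := [set r | roots e' r].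
have -> : n_comp e predT = #|A| by apply: eq_card => r; rewrite !inE andbT.
have -> : n_comp e' predT = #|A'| by apply: eq_card => r; rewrite !inE andbT.
have root_e' z z' : connect e' z z' = (fingraph.root e' z == fingraph.root e' z') by rewrite root_connect.
have inj : {in A' &, injective (fingraph.root e)}.
  move=> r s; rewrite !inE => /eqP r' /eqP s' /eqP.
  by rewrite root_connect // => /cee'; rewrite root_e' r' s' => /eqP.
have sub : fingraph.root e @: A' \subset A.
  by apply/fintype.subsetP => _ /imsetP [r _ ->]; rewrite inE roots_root.
rewrite -(card_in_imset inj); apply: proper_card; rewrite properE sub /=.
apply: contra exy => /fintype.subsetP AA'.
have key z : connect e z (fingraph.root e' z).
  have /imsetP [r] : fingraph.root e z \in fingraph.root e @: A' by apply: AA'; rewrite inE roots_root.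
  rewrite inE => /eqP rr /eqP; rewrite root_connect // => zr.
  by have /cee' := zr; rewrite root_e' rr => /eqP ->.
by rewrite (connect_trans (key x)) // se (fingraph.rootP se' e'xy) key.
Qed.

(** * Cutsets, coboundaries and Tellegen's theorem *)

Section Kirchhoff.
Context {n m : nat} (tl hd : 'I_m -> 'I_n).

Definition coboundary (R : pzRingType) (b : 'rV[R]_m) : Prop :=
  exists e : 'I_n -> R, forall j, b ord0 j = e (tl j) - e (hd j).

(** Take the level set of the potential through one end of a branch where [b] is nonzero. All
    branches that leave it carry a nonzero difference, and removing them separates the two ends of
    that branch; a minimal subset that still increases the number of components is a cutset. *)
Lemma coboundary_cutset (R : pzRingType) (b : 'rV[R]_m) :
  coboundary R b -> b != 0 ->
  exists2 K, is_cutset tl hd K & forall j, j \in K -> b ord0 j != 0.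
Proof.
move=> [e be] bn0.
have /existsP [j0 bj0] : [exists j, b ord0 j != 0].
  apply: contraNT bn0; rewrite negb_exists => /forallP b0.
  by apply/eqP/rowP => j; rewrite mxE; apply/eqP; rewrite -[_ == _]negbK.
pose S := [pred x | e x == e (tl j0)].
pose K := [set j | S (tl j) != S (hd j)].
pose P (L : {set 'I_m}) := (ncomp tl hd [set: 'I_m] < ncomp tl hd (~: L))%N.
have PK : P K.
  apply: (@n_comp_lt _ _ _ (tl j0) (hd j0)).
  - exact: gadj_connect_sym.
  - exact: gadj_connect_sym.
  - move=> x y /existsP [j /andP [_ jxy]].
    by apply/existsP; exists j; rewrite jxy finset.in_setT.
  - by apply/connect1/existsP; exists j0; rewrite finset.in_setT !eqxx.
  have Scl : fingraph.closed (gadj tl hd (~: K)) S.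
    move=> x y /existsP [j /andP []]; rewrite finset.in_setC inE negbK !inE.
    by move=> /eqP SE /orP [] /andP [/eqP<- /eqP<-].
  apply/negP => /(closed_connect Scl); rewrite !inE eqxx => /esym/eqP ehj.
  by rewrite be ehj subrr eqxx in bj0.
have [L /minsetP [PL Lmin] LK] := minset_exists PK.
exists L => [|j /(fintype.subsetP LK)].
  split; first exact: PL.
  move=> L' /properP [sL' [j jL jL']]; rewrite leqNgt; apply/negP => PL'.
  by rewrite (Lmin L') // jL in jL'.
by rewrite inE be subr_eq0; apply: contra => /eqP /= ->.
Qed.

(** Summation by parts: the sum regroups as potentials times net flows at the nodes. *)
Lemma circulation_coboundary (R : comPzRingType) (i v : 'rV[R]_m) :
  circulation tl hd R i -> coboundary R v -> \sum_j v ord0 j * i ord0 j = 0.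
Proof.
move=> ic [e ve].
transitivity (- \sum_x e x *
    \sum_(j < m) i ord0 j * ((hd j == x)%:R - (tl j == x)%:R)); last first.
  by rewrite big1 ?oppr0 // => x _; rewrite ic mulr0.
have ev (y : 'I_n) : e y = \sum_x e x * (y == x)%:R.
  by rewrite (bigD1 y) //= eqxx mulr1 big1 ?addr0 // => x /negPf;
    rewrite eq_sym => ->; rewrite mulr0.
under [X in - X]eq_bigr do rewrite mulr_sumr.
rewrite exchange_big /= -sumrN; apply: eq_bigr => j _.
rewrite ve (ev (tl j)) (ev (hd j)) -sumrB mulr_suml -sumrN.
by apply: eq_bigr => x _; rewrite -mulrBr -!mulrN opprB mulrAC mulrA.
Qed.

Lemma loop_row_circulation (R : nzRingType) (b : 'rV[R]_m) :
  loop_row tl hd b -> circulation tl hd R b.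
Proof. by case=> L [_ _ _]. Qed.

Lemma cutset_row_coboundary (R : nzRingType) (b : 'rV[R]_m) :
  cutset_row tl hd b -> coboundary R b.
Proof.
case=> K [S [_ KS bK]]; exists (fun x => (x \in S)%:R) => j.
rewrite bK KS; case: (tl j \in S); case: (hd j \in S);
  by rewrite /= ?subrr ?subr0 ?sub0r.
Qed.

Lemma circulation_mulmx (R : pzRingType) r (B : 'M[R]_(r, m)) (u : 'rV[R]_r) :
  (forall a, circulation tl hd R (row a B)) -> circulation tl hd R (u *m B).
Proof.
move=> Bc x; under eq_bigr do rewrite mxE mulr_suml.
rewrite exchange_big big1 //= => a _.
rewrite -[RHS](mulr0 (u ord0 a)) -[X in _ = _ * X](Bc a x) mulr_sumr.
by apply: eq_bigr => j _; rewrite mxE mulrA.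
Qed.

Lemma coboundary_mulmx (R : pzRingType) r (D : 'M[R]_(r, m)) (u : 'rV[R]_r) :
  (forall a, coboundary R (row a D)) -> coboundary R (u *m D).
Proof.
move=> /choice [e De]; exists (fun x => \sum_a u ord0 a * e a x) => j.
rewrite mxE -sumrB; apply: eq_bigr => a _; rewrite -mulrBr.
by have := De a j; rewrite mxE => ->.
Qed.

Context {R : fieldType} {rB rD : nat} {B : 'M[R]_(rB, m)} {D : 'M[R]_(rD, m)}.
Context (rlB : reduced_loop_matrix tl hd B).
Context (rcD : reduced_cutset_matrix tl hd D).

Let Bcirc a : circulation tl hd R (row a B).
Proof. by case: rlB => _ _ rows; apply: loop_row_circulation. Qed.

Let Dcob a : coboundary R (row a D).
Proof. by case: rcD => _ _ rows; apply: cutset_row_coboundary. Qed.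

Lemma loop_cutset_orth : B *m D^T = 0.
Proof.
apply/matrixP => a b; rewrite !mxE.
rewrite -[RHS](circulation_coboundary _ _ _ (Bcirc a) (Dcob b)).
by apply: eq_bigr => j _; rewrite !mxE mulrC.
Qed.

Lemma loop_cutset_rank : (rB + rD = m)%N.
Proof.
case: rlB rcD => rBE rkB _ [rDE rkD _].
have cn : (ncomp tl hd [set: 'I_m] <= n)%N.
  by rewrite -[X in (_ <= X)%N]card_ord; apply: max_card.
apply/eqP; rewrite eqn_leq; apply/andP; split.
  rewrite -{1}rkB -{1}rkD addnC -leq_subRL; last by rewrite rank_leq_col.
  by rewrite -[\rank D]mxrank_tr -mxrank_ker; apply/mxrankS/sub_kermxP/loop_cutset_orth.
rewrite rBE rDE; set c := ncomp _ _ _ in cn *.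
(* The subtraction in [rB = m + c - n] is truncated: if [m + c < n] then [rB = 0], and [m <= n - c]
   has to be shown directly. *)
have [nmc|/ltnW mcn] := leqP n (m + c); first by rewrite addnBA // subnK // addnK.
by rewrite (eqP mcn) add0n leq_subRL // addnC.
Qed.

Lemma KCL_mulmx (i : 'rV[R]_m) : D *m i^T = 0 -> exists b, i = b *m B.
Proof.
move=> Di; apply/submxP.
have <- : (kermx D^T :=: B)%MS.
  apply: kermx_tr_eqmx; first exact: loop_cutset_orth.
  by case: rlB rcD => _ -> _ [_ -> _]; rewrite loop_cutset_rank.
by apply/sub_kermxP; rewrite -[i]trmxK -trmx_mul Di trmx0.
Qed.

Lemma KVL_mulmx (v : 'rV[R]_m) : B *m v^T = 0 -> exists b, v = b *m D.
Proof.
move=> Bv; apply/submxP.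
have <- : (kermx B^T :=: D)%MS.
  apply: kermx_tr_eqmx; first by rewrite -[D]trmxK -trmx_mul loop_cutset_orth trmx0.
  by case: rlB rcD => _ -> _ [_ -> _]; rewrite addnC loop_cutset_rank.
by apply/sub_kermxP; rewrite -[v]trmxK -trmx_mul Bv trmx0.
Qed.

Lemma KCL_circulation (i : 'rV[R]_m) : D *m i^T = 0 -> circulation tl hd R i.
Proof. by move/KCL_mulmx=> [b ->]; apply: circulation_mulmx Bcirc. Qed.

Lemma KVL_coboundary (v : 'rV[R]_m) : B *m v^T = 0 -> coboundary R v.
Proof. by move/KVL_mulmx=> [b ->]; apply: coboundary_mulmx Dcob. Qed.

Lemma tellegen (v i : 'rV[R]_m) : B *m v^T = 0 -> D *m i^T = 0 ->
  \sum_j v ord0 j * i ord0 j = 0.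
Proof.
move=> /KVL_coboundary vc /KCL_circulation ic.
exact: circulation_coboundary ic vc.
Qed.

End Kirchhoff.

(** * Fixed points, strict derivatives, Picard-Lindelof *)

Local Open Scope classical_set_scope.

(** Banach's theorem with ratio 1/2, the sup distance being spelled out pointwise: functions need
    not be bounded, it is enough that [F g0] stays within [C] of [g0]. [T] will be time for Picard
    iteration and the parameter space for the implicit function. *)
Lemma uniform_contraction_fixpoint (R : realType) (T : Type) (V : completeNormedModType R)
    (A : set (T -> V)) (F : (T -> V) -> T -> V) (g0 : T -> V) (C : R) :
  A g0 -> (forall g, A g -> A (F g)) ->
  (forall g, (forall e, 0 < e -> exists2 h, A h & forall t, `|g t - h t| <= e) -> A g) ->
  (forall g h c, A g -> A h -> (forall t, `|g t - h t| <= c) ->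
     forall t, `|F g t - F h t| <= c / 2) ->
  (forall t, `|F g0 t - g0 t| <= C) ->
  exists2 g, A g & forall t, F g t = g t.
Proof.
move=> Ag0 AF Acl Fcontr FC.
have [[t0]|T0] := pselect (inhabited T); last first.
  by exists g0 => // t; case: T0; exists.
have C0 : 0 <= C by apply: le_trans (FC t0).
(* [q n] bounds the whole tail after stage [n]: since [q] halves at each stage, the increments
   [q n.+1 = q n - q n.+1] telescope. *)
pose u n := iter n F g0; pose q (n : nat) : R := (2 * C) / 2 ^+ n.
have q0 n : 0 <= q n by rewrite divr_ge0 ?mulr_ge0 ?exprn_ge0.
have qS n : q n.+1 = q n / 2 by rewrite /q exprS invfM mulrA mulrAC.
have Au n : A (u n) by elim: n => //= n; apply: AF.
have uS n t : `|u n.+1 t - u n t| <= q n.+1.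
  elim: n t => [|n IH] t; first by rewrite /q expr1 mulrAC divff // mul1r; apply: FC.
  by rewrite qS; apply: (Fcontr (u n.+1) (u n)).
have uD n k t : `|u (n + k)%N t - u n t| <= q n - q (n + k)%N.
  elim: k => [|k IH]; first by rewrite addn0 !subrr normr0.
  rewrite addnS; have -> : q n - q (n + k).+1 = q (n + k).+1 + (q n - q (n + k)%N).
    by rewrite qS; lra.
  by apply: le_trans (ler_distD (u (n + k)%N t) _ _) _; apply: lerD IH.
have uq n p t : (n <= p)%N -> `|u p t - u n t| <= q n.
  by move=> /subnKC <-; apply: le_trans (uD _ _ _) _; rewrite gerBl.
have q_small e : 0 < e -> exists n, q n < e.
  move=> e0; have q_cvg : q n @[n --> \oo] --> (0 : R).
    have -> : q = geometric (2 * C) 2^-1.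
      by apply/funext => n; rewrite /q /geometric /= exprVn.
    by apply: cvg_geometric; rewrite ger0_norm // invf_lt1 // ltr1n.
  have [N _ Nq] : \forall n \near \oo, `|0 - q n| < e by move/cvgrPdist_lt: q_cvg; apply.
  by exists N; have /= := Nq N (leqnn _); rewrite sub0r normrN ger0_norm.
have cvgu t : cvg (u n t @[n --> \oo]).
  apply/cauchy_cvgP/cauchy_exP => e e0; have [N qN] := q_small e e0.
  exists (u N t); exists N => // p /= Np; rewrite -ball_normE /= distrC.
  by apply: le_lt_trans qN; apply: uq.
pose g t := lim (u n t @[n --> \oo]).
have gu n t : `|g t - u n t| <= q n.
  apply/ler_addgt0Pl => e e0.
  have [N _ Ng] : \forall p \near \oo, `|g t - u p t| < e.
    by move/cvgrPdist_lt: (cvgu t); apply.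
  apply: le_trans (ler_distD (u (maxn n N) t) _ _) _.
  apply: lerD; first by apply/ltW/Ng; apply: leq_maxr.
  by apply: uq; apply: leq_maxl.
have Ag : A g.
  apply: Acl => e e0; have [N qN] := q_small e e0.
  by exists (u N) => // t; apply: le_trans (gu _ _) (ltW qN).
exists g => // t; apply/eqP; rewrite -subr_eq0 -normr_le0.
apply/ler_addgt0Pl => e e0; rewrite addr0; have [N qN] := q_small e e0.
apply: le_trans (ltW qN); rewrite [q N]splitr -qS {1}qS.
apply: le_trans (ler_distD (u N.+1 t) _ _) _.
apply: lerD; first by apply: (Fcontr g (u N)).
by rewrite distrC; apply: gu.
Qed.

Lemma ler_coord_norm (R : realDomainType) m n (M : 'M[R]_(m, n)) i j : `|M i j| <= `|M|.
Proof. by rewrite [leRHS]mx_normrE; apply: (le_bigmax _ _ (i, j)). Qed.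

Lemma rV_norm_le (R : realDomainType) n (M : 'rV[R]_n) c :
  0 <= c -> (forall j, `|M ord0 j| <= c) -> `|M| <= c.
Proof.
move=> c0 Mc; rewrite [leLHS]mx_normrE; apply/bigmax_leP; split=> // -[i j] _ /=.
by rewrite ord1.
Qed.

(** * Strict differentiability of maps of class C^1 *)

Section StrictDerivative.
Context {R : realType}.

(** Finitely many directions with coordinates bounded by the norm: what is needed to pass from
    continuity of each directional derivative to a bound uniform in the direction. *)
Definition findim (V : normedModType R) : Prop :=
  exists (I : finType) (e : I -> V) (c : I -> V -> R), forall h,
    h = \sum_i c i h *: e i /\ forall i, `|c i h| <= `|h|.

Lemma findim_R : findim R.
Proof.
exists unit, (fun=> 1), (fun=> id) => h; split=> //.
by rewrite (big_pred1 tt) => [|[]] //; rewrite [_ *: _]mulr1.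
Qed.

Lemma findim_rV n : findim 'rV[R]_n.
Proof.
exists 'I_n, (fun i => delta_mx ord0 i), (fun i (h : 'rV[R]_n) => h ord0 i) => h; split.
  exact: row_sum_delta.
by move=> i; apply: ler_coord_norm.
Qed.

Lemma findim_prod (V W : normedModType R) : findim V -> findim W -> findim (V * W)%type.
Proof.
move=> [I [e [c ec]]] [J [e' [c' ec']]].
exists (I + J)%type, (fun k => match k with inl i => (e i, 0) | inr j => (0, e' j) end).
exists (fun k h => match k with inl i => c i h.1 | inr j => c' j h.2 end) => -[h h'].
have [hE hc] := ec h; have [hE' hc'] := ec' h'; split; last first.
  move=> [i|j]; rewrite prod_normE /= le_max ?hc ?hc' ?orbT //.
rewrite big_sumType /=.
have -> : \sum_i c i h *: (e i, 0 : W) = (h, 0).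
  rewrite {2}hE; elim/big_rec2: _ => // i y _ _ ->.
  by congr pair; rewrite /= scaler0 add0r.
have -> : \sum_i c' i h' *: (0 : V, e' i) = (0, h').
  rewrite {2}hE'; elim/big_rec2: _ => // i y _ _ ->.
  by congr pair; rewrite /= scaler0 add0r.
by congr pair; rewrite /= ?addr0 ?add0r.
Qed.

Lemma is_derive_line (V : normedModType R) n (f : V -> 'rV[R]_n) x h j (s : R) :
  differentiable f (x + s *: h) ->
  is_derive s 1 (fun r => f (x + r *: h) ord0 j) ('d f (x + s *: h) h ord0 j).
Proof.
move=> df.
have dline : is_diff s (fun r : R => x + r *: h) ( *:%R^~ h).
  rewrite -[ *:%R^~ h]add0r.
  exact: is_diffD (is_diff_cst x s) (is_diff_scalel s h).
have dcoord : is_diff (f (x + s *: h)) (fun M : 'rV[R]_n => M ord0 j) (fun M => M ord0 j).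
  have coord_lin : linear (fun M : 'rV[R]_n => M ord0 j : R).
    by move=> k A B; rewrite !mxE.
  pose coordL : {linear 'rV[R]_n -> R} :=
    HB.pack (fun M : 'rV[R]_n => M ord0 j) (GRing.isLinear.Build _ _ _ _ _ coord_lin).
  rewrite -[fun M => _]/(coordL : _ -> _); apply: DiffDef.
    exact/linear_differentiable/coord_continuous.
  by rewrite diff_lin //; apply: coord_continuous.
have dfx := differentiableP df.
have dcomp : is_diff s (fun r => f (x + r *: h) ord0 j)
  (fun r => 'd f (x + s *: h) (r *: h) ord0 j).
  exact: (is_diff_comp (is_diff_comp dline dfx) dcoord).
apply: DeriveDef; first by apply/diff_derivable/ex_diff.
by rewrite deriveE ?diff_val ?scale1r //; apply: ex_diff.
Qed.

Definition strict_diff {V : normedModType R} (g : V -> R) (x0 : V) (l : V -> R) : Prop :=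
  forall e, 0 < e -> exists2 d, 0 < d & forall x x', `|x - x0| < d -> `|x' - x0| < d ->
    `|g x - g x' - l (x - x')| <= e * `|x - x'|.

Lemma C1_strict_diff (V : normedModType R) n (f : V -> 'rV[R]_n) x0 j :
  findim V -> C1 f ->
  strict_diff (fun x => f x ord0 j) x0 (fun h => 'd f x0 h ord0 j).
Proof.
move=> [I [b [c bc]]] [fd fC] e e0.
pose N : R := #|I|%:R.
have N0 : 0 < N + 1 by rewrite ltr_wpDl.
(* Each of the [#|I|] directions contributes at most [e / (N + 1)]; the added 1 keeps the quotient
   meaningful when there is no direction. *)
have : \forall x \near x0, forall i, `|'D_(b i) f x0 - 'D_(b i) f x| <= e / (N + 1).
  apply: filter_forall => i; have /cvgrPdist_le := fC (b i) x0.
  by apply; rewrite divr_gt0.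
move=> /nbhs_ballP [d /= d0 near_d]; exists d => // x x' xd xd'.
set h := x - x'.
(* The linear model at [x0] is subtracted beforehand, so that the increment of [phi] over [0, 1] is
   exactly the quantity to bound. The mean value point lies in the ball by convexity. *)
pose phi (s : R) := f (x' + s *: h) ord0 j - s * 'd f x0 h ord0 j.
have dphi (s : R) : is_derive s 1 phi ('d f (x' + s *: h) h ord0 j - 'd f x0 h ord0 j).
  have d1 := is_derive_line V n f x' h j s (fd _).
  have d2 : is_derive s 1 (fun r : R => r * 'd f x0 h ord0 j) ('d f x0 h ord0 j).
    have -> : (fun r : R => r * 'd f x0 h ord0 j) = 'd f x0 h ord0 j *: id.
      by apply/funext => r; rewrite mulrC.
    by apply: is_derive_eq; rewrite [LHS]mulr1.
  exact: is_deriveB d1 d2.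
have phiC : {within `[0, 1], continuous phi}%classic.
  by apply: derivable_within_continuous => s _; case: (dphi s).
have [s] := MVT_segment ler01 (fun s _ => dphi s) phiC.
rewrite in_itv /= subr0 mulr1 => /andP [s0 s1].
rewrite /phi scale1r scale0r addr0 mul0r subr0 mul1r /h subrKC -/h addrAC => ->.
set y := x' + s *: h.
have yd : ball x0 d y.
  rewrite -ball_normE /= distrC.
  have -> : y - x0 = (1 - s) *: (x' - x0) + s *: (x - x0).
    have hE : h = (x - x0) - (x' - x0) by rewrite opprB addrA subrK.
    by rewrite /y addrAC hE scalerBr scalerBl scale1r addrA addrAC.
  apply: le_lt_trans (ler_normD _ _) _; rewrite !normrZ !ger0_norm ?subr_ge0 //.
  have [ab|/ltW ba] := leP `|x - x0| `|x' - x0|.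
    by apply: le_lt_trans xd'; nra.
  by apply: le_lt_trans xd; nra.
have [hE hc] := bc h.
have dE z : 'd f z h = \sum_i c i h *: 'D_(b i) f z.
  rewrite {1}hE linear_sum; apply: eq_bigr => i _.
  by rewrite (deriveE _ (fd z)) linearZ.
rewrite !dE !summxE -sumrB.
apply: le_trans (ler_norm_sum _ _ _) _.
apply: (@le_trans _ _ (\sum_(i : I) `|h| * (e / (N + 1)))).
  apply: ler_sum => i _; rewrite !mxE -mulrBr normrM ler_pM //.
  have := near_d y yd i; rewrite distrC; apply: le_trans.
  by have := ler_coord_norm _ _ _ ('D_(b i) f y - 'D_(b i) f x0) ord0 j; rewrite !mxE.
rewrite sumr_const -[_ *+ #|_|]mulr_natr -/N -mulrA [leRHS]mulrC ler_wpM2l //.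
by rewrite mulrAC ler_pdivrMr // ler_pM2l // lerDl.
Qed.

End StrictDerivative.

HB.instance Definition _ (R : realType) m n := Complete.on 'M[R]_(m, n).

(** * Ordinary differential equations with Lipschitz right-hand side *)

Section Picard.
Context {R : realType}.

Lemma exists_primitive (g : R -> R) (t0 d : R) : 0 < d -> continuous g ->
  exists G : R -> R, G t0 = 0 /\ forall t, `|t - t0| < d -> is_derive t 1 G (g t).
Proof.
(* Integrating from [t0 - d] keeps the bounds in order on both sides of [t0]; the value at [t0] is
   subtracted afterwards. *)
move=> d0 gC; pose F x := (\int[lebesgue_measure]_(t in `[t0 - d, x]) g t)%R.
exists (fun x => F x - F t0); split=> [|t]; first by rewrite subrr.
rewrite ltr_distl => /andP [td tD].
have gi : lebesgue_measure.-integrable `[t0 - d, t0 + d] (EFin \o g).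
  apply: continuous_compact_integrable; first exact: segment_compact.
  exact: continuous_subspaceT.
have [dF F'] := continuous_FTC1_closed tD gi td (gC t).
rewrite -[g t]subr0; apply: is_deriveB.
by apply: DeriveDef; [exact: dF | rewrite -derive1E F'].
Qed.

Lemma derive_le_lipschitz (g g' : R -> R) (t0 d c s t : R) :
  (forall t, `|t - t0| < d -> is_derive t 1 g (g' t)) ->
  (forall t, `|t - t0| < d -> `|g' t| <= c) ->
  `|s - t0| < d -> `|t - t0| < d -> `|g s - g t| <= c * `|s - t|.
Proof.
wlog st : s t / s <= t => [H|dg g'c sd td].
  by case/orP: (le_total s t) => ? *; [|rewrite distrC [`|s - t|]distrC]; apply: H.
have itv_d x : x \in `[s, t]%R -> `|x - t0| < d.
  rewrite in_itv /= => /andP [sx xt].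
  by move: sd td; rewrite !ltr_distl => /andP [? ?] /andP [? ?]; lra.
have [||x xst E] := @MVT_segment _ g g' s t st.
- by move=> x xst; apply/dg/itv_d/subset_itv_oo_cc.
- by apply: derivable_within_continuous => x /itv_d/dg [].
by rewrite distrC E normrM [`|s - t|]distrC ler_wpM2r // g'c // itv_d.
Qed.

Lemma exists_primitive_rV n (g : R -> 'rV[R]_n) (t0 d : R) : 0 < d -> continuous g ->
  exists G : R -> 'rV[R]_n, G t0 = 0 /\ forall j t, `|t - t0| < d ->
    is_derive t 1 (fun s => G s ord0 j) (g t ord0 j).
Proof.
move=> d0 gC.
have /choice [G GP] : forall j, exists G : R -> R, G t0 = 0 /\
    forall t, `|t - t0| < d -> is_derive t 1 G (g t ord0 j).
  move=> j; apply: (exists_primitive (fun t => g t ord0 j)) => // t.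
  apply: (@continuous_comp _ _ _ g (fun M : 'rV[R]_n => M ord0 j)); first exact: gC.
  exact: coord_continuous.
exists (fun t => \row_j G j t); split.
  by apply/rowP => j; rewrite !mxE (GP j).1.
move=> j t /(GP j).2; congr is_derive.
by apply/funext => s; rewrite mxE.
Qed.

Lemma lipschitz_continuous n (g : R -> 'rV[R]_n) c :
  (forall s t, `|g s - g t| <= c * `|s - t|) -> continuous g.
Proof.
move=> gc t; apply/cvgrPdist_le => e e0.
have c0 : 0 < `|c| + 1 by rewrite ltr_wpDl.
near=> s; apply: le_trans (gc _ _) _.
apply: (@le_trans _ _ ((`|c| + 1) * `|t - s|)).
  by rewrite ler_wpM2r //; apply: le_trans (ler_norm c) _; rewrite lerDl.
rewrite mulrC -ler_pdivlMr //; near: s.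
by apply: cvgr_dist_le (@cvg_id _ _) _ _; rewrite divr_gt0.
Unshelve. all: by end_near. Qed.

(** Projection onto [t0 - d, t0 + d]. Composing with it makes local estimates hold for all real
    times, as the sup distance over the whole line requires. *)
Definition clamp (t0 d t : R) : R := Num.max (t0 - d) (Num.min (t0 + d) t).

Lemma clamp_bound (t0 d t : R) : 0 <= d -> `|clamp t0 d t - t0| <= d.
Proof.
move=> d0; rewrite ler_distl /clamp; case: (leP (t0 + d) t) => ?;
  case: (leP (t0 - d) (t0 + d)) => ?; case: (leP (t0 - d) t) => ?; apply/andP; split; lra.
Qed.

Lemma clamp_id (t0 d t : R) : `|t - t0| <= d -> clamp t0 d t = t.
Proof.
rewrite ler_distl => /andP [? ?]; rewrite /clamp min_r // max_r //.
Qed.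

Lemma clamp_contract (t0 d s t : R) : `|clamp t0 d s - clamp t0 d t| <= `|s - t|.
Proof.
have le1 := ler_norm (s - t); have le2 := ler_norm (t - s); rewrite distrC in le2.
rewrite ler_norml.
rewrite /clamp; case: (leP (t0 + d) s) => ?; case: (leP (t0 + d) t) => ?;
  case: (leP (t0 - d) (t0 + d)) => ?; case: (leP (t0 - d) s) => ?;
  case: (leP (t0 - d) t) => ?; apply/andP; split; lra.
Qed.

(** One [d] serves all initial values within [r / 2] of [z0]; the other [r / 2] is the room in which
    the solution may move. *)
Theorem picard_lindelof n (f : 'rV[R]_n -> R -> 'rV[R]_n) z0 t0 r K :
  0 < r -> 0 < K ->
  (forall z z' t t', `|z - z0| <= r -> `|z' - z0| <= r -> `|t - t0| <= r ->
     `|t' - t0| <= r -> `|f z t - f z' t'| <= K * (`|z - z'| + `|t - t'|)) ->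
  exists2 d, 0 < d & forall a, `|a - z0| <= r / 2 ->
    exists w : R -> 'rV[R]_n, w t0 = a /\ forall t, `|t - t0| < d ->
      `|w t - z0| <= r /\
      forall j, is_derive t 1 (fun s => w s ord0 j) (f (w t) t ord0 j).
Proof.
move=> r0 K0 fK; pose M := `|f z0 t0| + K * (r + r).
have M0 : 0 < M by rewrite ltr_wpDl // mulr_gt0 // addr_gt0.
have fM z t : `|z - z0| <= r -> `|t - t0| <= r -> `|f z t| <= M.
  move=> zr tr; rewrite -[f z t](subrK (f z0 t0)) addrC.
  apply: le_trans (ler_normD _ _) _; rewrite lerD2l.
  have z0r : `|z0 - z0| <= r by rewrite subrr normr0 ltW.
  have t0r : `|t0 - t0| <= r by rewrite subrr normr0 ltW.
  by apply: le_trans (fK _ _ _ _ zr z0r tr t0r) _; rewrite ler_pM2l // lerD.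
(* [M] bounds the speed: [d <= r / (2 * M)] limits the motion to [r / 2], and [d <= (2 * K)^-1]
   makes the integral operator contract by 1/2. *)
pose d := Num.min r (Num.min (r / (2 * M)) (2 * K)^-1).
have d0 : 0 < d by rewrite !lt_min r0 divr_gt0 ?invr_gt0 ?mulr_gt0.
have dr : d <= r by rewrite ge_min lexx.
have Md : M * d <= r / 2.
  rewrite -ler_pdivlMl // mulrC -mulrA -invfM ge_min; apply/orP; right.
  by rewrite ge_min lexx.
have Kd : K * d <= 2^-1.
  rewrite -ler_pdivlMl // -invfM mulrC ge_min; apply/orP; right.
  by rewrite ge_min lexx orbT.
exists d => // a ar.
(* The Lipschitz condition makes the integrand [phi u] continuous and, unlike differentiability,
   survives uniform limits. *)
pose A (u : R -> 'rV[R]_n) := (forall t, `|u t - z0| <= r) /\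
  forall s t, `|u s - u t| <= M * `|s - t|.
pose phi (u : R -> 'rV[R]_n) t := f (u t) (clamp t0 d t).
have clr t : `|clamp t0 d t - t0| <= r by apply: le_trans (clamp_bound _ _ _ (ltW d0)) dr.
have phiM u t : A u -> `|phi u t| <= M by move=> [ur _]; apply: fM.
have phiC u : A u -> continuous (phi u).
  move=> [ur uM]; apply: (lipschitz_continuous _ _ (K * (M + 1))) => s t.
  apply: le_trans (fK _ _ _ _ (ur _) (ur _) (clr _) (clr _)) _.
  rewrite -mulrA ler_pM2l // mulrDl mul1r lerD //.
  exact: clamp_contract.
(* Primitives are taken on radius [d + d], so that the closed interval reached by [clamp] lies
   inside the open one where they are differentiable. *)
have dd : d < d + d by rewrite ltrDl.
have dd0 : 0 < d + d by apply: lt_trans dd.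
have /choice [P PP] : forall u, exists G : R -> 'rV[R]_n, A u -> G t0 = 0 /\
    forall j t, `|t - t0| < d + d -> is_derive t 1 (fun s => G s ord0 j) (phi u t ord0 j).
  move=> u; have [Au|nAu] := pselect (A u); last by exists (fun=> 0).
  have [G GP] := exists_primitive_rV _ _ t0 _ dd0 (phiC u Au).
  by exists G.
have cld t : `|clamp t0 d t - t0| < d + d.
  by apply: le_lt_trans dd; apply: clamp_bound (ltW d0).
have t0dd : `|t0 - t0| < d + d by rewrite subrr normr0.
have P_lip u s t : A u -> `|s - t0| < d + d -> `|t - t0| < d + d ->
    `|P u s - P u t| <= M * `|s - t|.
  move=> Au sd td; apply: rV_norm_le => [|j]; first by rewrite mulr_ge0 // ltW.
  rewrite !mxE; apply: (derive_le_lipschitz _ _ t0 _ M _ _ ((PP u Au).2 j)) => // x _.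
  by apply: le_trans (phiM u x Au); apply: ler_coord_norm.
pose F u t := a + P u (clamp t0 d t).
have FA u : A u -> A (F u).
  move=> Au; split=> [t|s t]; last first.
    rewrite /F opprD addrACA subrr add0r; apply: le_trans (P_lip _ _ _ Au _ _) _ => //.
    by rewrite ler_pM2l ?clamp_contract.
  rewrite /F addrAC; apply: le_trans (ler_normD _ _) _; rewrite [leRHS]splitr lerD //.
  have := P_lip u (clamp t0 d t) t0 Au (cld t) t0dd; rewrite (PP u Au).1 subr0.
  move/le_trans; apply; apply: le_trans Md.
  by rewrite ler_pM2l // clamp_bound // ltW.
have Aa : A (cst a).
  split=> *; first by apply: le_trans ar _; rewrite ler_pdivrMr // ler_peMr ?ltW // ltr1n.
  by rewrite subrr normr0 mulr_ge0 // ltW.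
have [|||u Au Fu] := uniform_contraction_fixpoint _ _ _ A F (cst a) (r + r) Aa FA.
- move=> u uA; split=> [t|s t]; apply/ler_addgt0Pl => e e0.
    have [h [hr _] uh] := uA e e0; apply: le_trans (ler_distD (h t) _ _) _.
    exact: lerD.
  have e20 : 0 < e / 2 by rewrite divr_gt0.
  have [h [_ hM] uh] := uA _ e20; apply: le_trans (ler_distD (h s) _ _) _.
  rewrite [e]splitr -addrA; apply: lerD => //.
  by apply: le_trans (ler_distD (h t) _ _) _; rewrite addrC lerD // distrC.
- move=> u v c Au Av uv t; rewrite /F opprD addrACA subrr add0r.
  have c0 : 0 <= c by apply: le_trans (uv t0).
  apply: rV_norm_le => [|j]; first by rewrite divr_ge0.
  pose g s := P u s ord0 j - P v s ord0 j.
  have g0 : g t0 = 0 by rewrite /g (PP u Au).1 (PP v Av).1 !mxE subrr.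
  have -> : (P u (clamp t0 d t) - P v (clamp t0 d t)) ord0 j = g (clamp t0 d t) - g t0.
    by rewrite g0 subr0 !mxE.
  apply: (@le_trans _ _ (K * c * `|clamp t0 d t - t0|)); last first.
    apply: (@le_trans _ _ (K * c * d)); last by rewrite mulrAC mulrC ler_wpM2l.
    by rewrite ler_wpM2l ?clamp_bound ?mulr_ge0 // ltW.
  apply: (derive_le_lipschitz g (fun s => phi u s ord0 j - phi v s ord0 j) t0 (d + d)) => //.
    by move=> s sd; apply: is_deriveB; [exact: (PP u Au).2|exact: (PP v Av).2].
  move=> s _; have := ler_coord_norm _ _ _ (phi u s - phi v s) ord0 j; rewrite !mxE.
  move/le_trans; apply; apply: le_trans (fK _ _ _ _ _ _ (clr s) (clr s)) _; try by case: Au; case: Av.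
  by rewrite subrr normr0 addr0 ler_wpM2l // ltW.
- move=> t; apply: le_trans (ler_distD z0 _ _) _; rewrite lerD //; first exact: (FA _ Aa).1.
  by rewrite distrC; exact: Aa.1.
exists (fun t => a + P u t); split=> [|t td]; first by rewrite (PP u Au).1 addr0.
have uE : a + P u t = u t by rewrite -Fu /F clamp_id // ltW.
rewrite uE; split=> [|j]; first exact: Au.1.
have := (PP u Au).2 j t (lt_trans td dd); rewrite /phi clamp_id ?ltW // => du.
have -> : (fun s => (a + P u s) ord0 j) = cst (a ord0 j) + (fun s => P u s ord0 j).
  by apply/funext => s; rewrite !mxE.
by rewrite -[f _ _ _ _]add0r; apply: is_deriveD.
Qed.

End Picard.

Lemma mulmx_bounded (R : realType) m n (K : 'M[R]_(m, n)) :
  exists2 c, 0 < c & forall v : 'rV[R]_m, `|v *m K| <= c * `|v|.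
Proof.
exists (m%:R * `|K| + 1) => [|v]; first by rewrite ltr_wpDl // mulr_ge0.
apply: rV_norm_le => [|j]; first by rewrite mulr_ge0 // addr_ge0 // mulr_ge0.
rewrite mxE; apply: le_trans (ler_norm_sum _ _ _) _.
apply: (@le_trans _ _ (\sum_(i < m) `|v| * `|K|)).
  by apply: ler_sum => i _; rewrite normrM ler_pM // ler_coord_norm.
by rewrite sumr_const card_ord -[leLHS]mulr_natl mulrDl mul1r -mulrA [`|K| * _]mulrC lerDl //.
Qed.

(* Solution of [Psi x y = 0] near [(x0, y0)] by the simplified Newton map
   [y - Psi x y *m K], where [K] inverts the partial derivative at [(x0, y0)]. *)
Lemma lipschitz_implicit_function (R : realType) (X : normedModType R) N m
    (Psi : X -> 'rV[R]_N -> 'rV[R]_m) (L : 'M[R]_(N, m)) (K : 'M[R]_(m, N)) x0 y0 C d0 :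
  L *m K = 1%:M -> K *m L = 1%:M -> Psi x0 y0 = 0 -> 0 < C -> 0 < d0 ->
  (forall e, 0 < e -> exists2 d, 0 < d & forall x y y', `|x - x0| < d ->
     `|y - y0| < d -> `|y' - y0| < d ->
     `|Psi x y - Psi x y' - (y - y') *m L| <= e * `|y - y'|) ->
  (forall x x' y, `|x - x0| < d0 -> `|x' - x0| < d0 -> `|y - y0| < d0 ->
     `|Psi x y - Psi x' y| <= C * `|x - x'|) ->
  exists (Y : X -> 'rV[R]_N) (d c : R), [/\ 0 < d, 0 < c,
    forall x, `|x - x0| <= d -> Psi x (Y x) = 0 &
    forall x x', `|x - x0| <= d -> `|x' - x0| <= d -> `|Y x - Y x'| <= c * `|x - x'|].
Proof.
move=> LK KL Psi0 C0 d00 Psi_y Psi_x.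
have [c c0 cK] := mulmx_bounded _ _ _ K.
(* Multiplication by [K] costs a factor [c], so the error [(2 * c)^-1] makes the Newton map contract
   by 1/2. *)
have [|d1 d10 {}Psi_y] := Psi_y (2 * c)^-1; first by rewrite invr_gt0 mulr_gt0.
pose r := Num.min d0 d1 / 2.
have r0 : 0 < r by rewrite divr_gt0 // lt_min d00.
have rd : r < Num.min d0 d1 by rewrite gtr_pMr ?invf_lt1 ?ltr1n // lt_min d00.
have [rd0 rd1] : r < d0 /\ r < d1 by move: rd; rewrite lt_min => /andP.
(* Moving [x] within [d] of [x0] displaces [T x y0] by at most [r / 2]; contraction in [y] uses the
   other half, so the [r]-ball is stable. *)
pose d := Num.min r (r / (2 * (c * C))).
have dl0 : 0 < d by rewrite lt_min r0 /= divr_gt0 // !mulr_gt0.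
have dr : d <= r by rewrite ge_min lexx.
have dcC : c * C * d <= r / 2.
  by rewrite -ler_pdivlMl ?mulr_gt0 // mulrC -mulrA -invfM /d ge_min lexx orbT.
pose T x y := y - Psi x y *m K.
have T_y x y y' : `|x - x0| <= d -> `|y - y0| <= r -> `|y' - y0| <= r ->
    `|T x y - T x y'| <= `|y - y'| / 2.
  move=> xd yr yr'.
  have -> : T x y - T x y' = - ((Psi x y - Psi x y' - (y - y') *m L) *m K).
    rewrite (mulmxBl (Psi x y - _)) -mulmxA LK mulmx1 opprB mulmxBl /T.
    by rewrite !opprB addrACA [in RHS]addrACA [X in _ = _ + X]addrC.
  rewrite normrN; apply: le_trans (cK _) _; rewrite -ler_pdivlMl //.
  apply: le_trans (Psi_y _ _ _ _ _ _) _; try by apply: le_lt_trans rd1 => //; apply: le_trans dr.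
  by rewrite invfM [2^-1 * _]mulrC -mulrA [2^-1 * _]mulrC.
have T_x x x' y : `|x - x0| <= d -> `|x' - x0| <= d -> `|y - y0| <= r ->
    `|T x y - T x' y| <= c * C * `|x - x'|.
  move=> xd xd' yr; rewrite /T opprD addrACA subrr add0r -opprD normrN -mulmxBl.
  apply: le_trans (cK _) _; rewrite -mulrA ler_pM2l //.
  by apply: Psi_x; apply: le_lt_trans rd0 => //; apply: le_trans dr.
have x0d : `|x0 - x0| <= d by rewrite subrr normr0 ltW.
have y0r : `|y0 - y0| <= r by rewrite subrr normr0 ltW.
have T0 : T x0 y0 = y0 by rewrite /T Psi0 mul0mx subr0.
have T_ball x y : `|x - x0| <= d -> `|y - y0| <= r -> `|T x y - y0| <= r.
  move=> xd yr; rewrite [leRHS]splitr; apply: le_trans (ler_distD (T x y0) _ _) _.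
  apply: lerD; first by apply: le_trans (T_y _ _ _ xd yr y0r) _; rewrite ler_pM2r.
  rewrite -[X in _ - X]T0; apply: le_trans (T_x _ _ _ xd x0d y0r) _.
  by apply: le_trans dcC; rewrite ler_pM2l // mulr_gt0.
pose A (Y : X -> 'rV[R]_N) := forall x, `|Y x - y0| <= r.
pose F (Y : X -> 'rV[R]_N) x := if `|x - x0| <= d then T x (Y x) else y0.
have FA Y : A Y -> A (F Y).
  by move=> YA x; rewrite /F; case: ifP => // xd; apply: T_ball.
have Aa : A (fun=> y0) by [].
have [|||Y YA FY] := uniform_contraction_fixpoint _ _ _ A F (fun=> y0) r Aa FA.
- move=> Y YA x; apply/ler_addgt0Pl => e e0; have [Z ZA YZ] := YA e e0.
  by apply: le_trans (ler_distD (Z x) _ _) _; apply: lerD.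
- move=> Y Z b YA ZA YZ x; rewrite /F; case: ifP => xd.
    by apply: le_trans (T_y _ _ _ xd (YA x) (ZA x)) _; rewrite ler_pM2r.
  by rewrite subrr normr0 divr_ge0 //; apply: le_trans (YZ x).
- by move=> x; apply: FA.
have YT x : `|x - x0| <= d -> T x (Y x) = Y x by move=> xd; rewrite -[RHS]FY /F xd.
exists Y, d, (2 * (c * C)); split=> //; first by rewrite !mulr_gt0.
  move=> x /YT /eqP; rewrite /T -subr_eq0 addrAC subrr add0r oppr_eq0 => /eqP PK.
  by rewrite -[LHS]mulmx1 -KL mulmxA PK mul0mx.
move=> x x' xd xd'.
(* The half on the right is absorbed on the left, whence the constant [2 * (c * C)]. *)
have : `|Y x - Y x'| <= `|Y x - Y x'| / 2 + c * C * `|x - x'|.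
  rewrite -{1}(YT x xd) -{1}(YT x' xd').
  apply: le_trans (ler_distD (T x (Y x')) _ _) _.
  by apply: lerD; [apply: T_y|apply: T_x].
lra.
Qed.

(** * The circuit equations *)

Definition current_driven (c : dclass) : bool :=
  match c with QMem | Cap | CRes | VSrc => true | _ => false end.

(** The classes whose law depends on the controlling variable, that is, those carrying [M], [R], [W]
    or [G]. *)
Definition resistive (c : dclass) : bool :=
  match c with QMem | CRes | PMem | VRes => true | _ => false end.

(** By Tellegen's theorem the four resistive sums, each nonnegative, add up to 0, so none is
    positive. Then [v] can be nonzero only on inductors and current sources, and [i] only on
    capacitors and voltage sources. The alternative in the last hypothesis is shaped to fit both
    strict monotonicity and positive definiteness. *)
Lemma circuit_zero (R : realFieldType) n m (tl hd : 'I_m -> 'I_n) (cls : 'I_m -> dclass)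
    rB rD (B : 'M[R]_(rB, m)) (D : 'M[R]_(rD, m)) (v i : 'rV[R]_m) :
  reduced_loop_matrix tl hd B -> reduced_cutset_matrix tl hd D ->
  (forall L : {set 'I_m}, is_loop tl hd L ->
     ~ (forall j, j \in L -> cls j = VSrc \/ cls j = Cap)) ->
  (forall K : {set 'I_m}, is_cutset tl hd K ->
     ~ (forall j, j \in K -> cls j = CSrc \/ cls j = Ind)) ->
  B *m v^T = 0 -> D *m i^T = 0 ->
  (forall j, cls j = VSrc \/ cls j = Cap -> v ord0 j = 0) ->
  (forall j, cls j = CSrc \/ cls j = Ind -> i ord0 j = 0) ->
  (forall c, resistive c ->
     (forall j, cls j = c -> v ord0 j = 0 /\ i ord0 j = 0) \/
     0 < \sum_(j < m | cls j == c) v ord0 j * i ord0 j) ->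
  v = 0 /\ i = 0.
Proof.
move=> rlB rcD noVC noIL Bv Di v0 i0 pos.
pose S c := \sum_(j < m | cls j == c) v ord0 j * i ord0 j.
have S0 c : resistive c -> 0 <= S c.
  move=> /pos [z|/ltW //]; rewrite /S big1 // => j /eqP cj.
  by rewrite (z j cj).1 mul0r.
have sumS : S QMem + S CRes + S PMem + S VRes = 0.
  rewrite -[RHS](tellegen tl hd rlB rcD v i Bv Di) /S.
  rewrite big_mkcond [X in _ + X + _ + _]big_mkcond [X in _ + X + _]big_mkcond.
  rewrite [X in _ + X]big_mkcond -!big_split; apply: eq_bigr => j _ /=.
  case cj: (cls j) => /=; rewrite ?addr0 ?add0r //.
  - by rewrite (v0 j) ?mul0r //; right.
  - by rewrite (v0 j) ?mul0r //; left.
  - by rewrite (i0 j) ?mulr0 //; right.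
  - by rewrite (i0 j) ?mulr0 //; left.
have zero c : resistive c -> forall j, cls j = c -> v ord0 j = 0 /\ i ord0 j = 0.
  move=> rc; case: (pos c rc) => // Sc; exfalso.
  have := S0 QMem isT; have := S0 CRes isT; have := S0 PMem isT; have := S0 VRes isT.
  by move: Sc; rewrite -/(S c); case: c rc => // _; lra.
split.
- apply/eqP/negPn/negP => vn0.
  have [K Kcut Kv] := coboundary_cutset _ _ _ _ (KVL_coboundary _ _ rlB rcD v Bv) vn0.
  apply: (noIL K Kcut) => j /Kv /eqP vj; case cj: (cls j);
    first [by left | by right | case: vj; first [exact: (zero _ _ _ cj).1 |
      by apply: v0; left | by apply: v0; right]].
- apply/eqP/negPn/negP => in0.
  have [L Lloop Li] := circulation_loop _ _ _ _ (KCL_circulation _ _ rlB rcD i Di) in0.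
  apply: (noVC L Lloop) => j /Li /eqP ij; case cj: (cls j);
    first [by left | by right | case: ij; first [exact: (zero _ _ _ cj).2 |
      by apply: i0; left | by apply: i0; right]].
Qed.

(** Transfers locality from values to derivatives: locality controls only the coordinates of one
    class, hence equality in a single coordinate along a single line. *)
Lemma diff_line_eq (R : realType) (V W : normedModType R) n (f : V -> 'rV[R]_n)
    (g : W -> 'rV[R]_n) x h y k j :
  differentiable f x -> differentiable g y ->
  (forall s : R, f (x + s *: h) ord0 j = g (y + s *: k) ord0 j) ->
  'd f x h ord0 j = 'd g y k ord0 j.
Proof.
move=> df dg fg.
have := is_derive_line V n f x h j 0; have := is_derive_line W n g y k j 0.
rewrite !scale0r !addr0 (funext fg) => /(_ dg) dg0 /(_ df) df0.
by rewrite -(@derive_val _ _ _ _ _ _ _ dg0) -(@derive_val _ _ _ _ _ _ _ df0).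
Qed.

(** * Positive definite derivatives and strict monotonicity *)

Section ResistiveClass.
Context {R : realType} {m : nat} (cls : 'I_m -> dclass) (c : dclass).
Context (f : 'rV[R]_m -> 'rV[R]_m) (df : forall x, differentiable f x).
Context (floc : forall x x', agree_on cls c x x' -> agree_on cls c (f x) (f x')).
Context (fpos : forall x, posdef_on cls c ('d f x)).

Lemma posdef_dichotomy (x w : 'rV[R]_m) :
  (forall j, cls j = c -> w ord0 j = 0 /\ 'd f x w ord0 j = 0) \/
  0 < \sum_(j < m | cls j == c) w ord0 j * 'd f x w ord0 j.
Proof.
pose w' : 'rV[R]_m := \row_j (if cls j == c then w ord0 j else 0).
have ww' : agree_on cls c w' w by move=> j /eqP cj; rewrite mxE cj.
have dww' : agree_on cls c ('d f x w') ('d f x w).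
  move=> j cj; apply: diff_line_eq => // s; apply: floc cj => k ck.
  by rewrite !mxE ck eqxx.
have [w0|wn0] := eqVneq w' 0.
  left=> j cj; rewrite -ww' // -dww' // w0; split; first by rewrite mxE.
  by rewrite linear0 mxE.
right; have := fpos x w'; rewrite (eq_bigr (fun j => w ord0 j * 'd f x w ord0 j)).
  by apply=> // k /negPf kc; rewrite mxE kc.
by move=> j /eqP cj; rewrite ww' // dww'.
Qed.

Lemma posdef_monotone (u u' : 'rV[R]_m) :
  agree_on cls c u u' \/
  0 < \sum_(j < m | cls j == c) (u - u') ord0 j * (f u - f u') ord0 j.
Proof.
pose w : 'rV[R]_m := \row_j (if cls j == c then (u - u') ord0 j else 0).
have wsupp : supp_in cls c w by move=> k /negPf kc; rewrite mxE kc.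
have [w0|wn0] := eqVneq w 0.
  left=> j /eqP cj; apply/eqP; rewrite -subr_eq0.
  by move/rowP/(_ j): w0; rewrite !mxE cj => ->.
(* [v] agrees with [u'] on class [c] and with [u] elsewhere. The segment from [v] to [u] thus moves
   only inside the class, where positive definiteness applies, and the mean value theorem is used on
   the scalar function [phi]. *)
right; pose v := u - w.
have vu' : agree_on cls c u' v by move=> j /eqP cj; rewrite !mxE cj opprB subrKC.
pose phi (s : R) := \sum_(j < m | cls j == c) w ord0 j * f (v + s *: w) ord0 j.
have dphi (s : R) : is_derive s 1 phi
    (\sum_(j < m | cls j == c) w ord0 j * 'd f (v + s *: w) w ord0 j).
  have -> : phi = \sum_(j < m | cls j == c)
      w ord0 j *: (fun r : R => f (v + r *: w) ord0 j).
    by apply/funext => r; rewrite fct_sumE.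
  elim/big_ind2: _ => [|F dF G dG HF HG|j _]; first exact: is_derive_cst.
    exact: is_deriveD.
  by have := is_derive_line _ _ f v w j s (df _); apply: is_deriveZ.
have phiC : {within `[0, 1], continuous phi}%classic.
  by apply: derivable_within_continuous => s _; case: (dphi s).
have [s _] := MVT_segment ler01 (fun s _ => dphi s) phiC.
rewrite subr0 mulr1 /phi -sumrB scale1r scale0r addr0 => E.
have := fpos (v + s *: w) w wsupp wn0; rewrite -E.
rewrite (eq_bigr (fun j => (u - u') ord0 j * (f u - f u') ord0 j)) //.
move=> j /eqP cj; rewrite -mulrBr /v subrK -(floc _ _ vu' j cj) mxE cj eqxx.
by rewrite !mxE.
Qed.

End ResistiveClass.

Lemma C1_comp_linear (R : realType) (U V W : normedModType R) (p : {linear U -> V})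
    (f : V -> W) :
  continuous p -> C1 f -> C1 (f \o p).
Proof.
move=> pC [fd fC].
have pd x : differentiable p x by apply: linear_differentiable.
have fpd x : differentiable (f \o p) x by apply: differentiable_comp.
have DE u x : 'D_u (f \o p) x = 'D_(p u) f (p x).
  by rewrite !deriveE // diff_comp //= (diff_lin _ pC).
split=> [//|u]; rewrite (funext (DE u)) => x.
by apply: (@continuous_comp _ _ _ p ('D_(p u) f)); [apply: pC|apply: fC].
Qed.

(** * Device laws in controlling and controlled variables *)

Section Laws.
Context {R : realType} {m : nat} (cls : 'I_m -> dclass) (dv : devices R m).

(* [p] stands for [(z, u, t)], where [u] lists the controlling variable of
   every branch: the current of q-devices and the voltage of phi-devices. *)
Definition law (c : dclass) (p : 'rV[R]_m * 'rV[R]_m * R) : 'rV[R]_m :=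
  match c with
  | QMem => eta1 dv p.1.1 p.1.2 p.2
  | Cap => eta2 dv p.1.1 p.2
  | CRes => eta3 dv p.1.2 p.2
  | VSrc => eta4 dv p.2
  | PMem => zeta1 dv p.1.1 p.1.2 p.2
  | Ind => zeta2 dv p.1.1 p.2
  | VRes => zeta3 dv p.1.2 p.2
  | CSrc => zeta4 dv p.2
  end.

Lemma law_C1 c : devices_C1 dv -> C1 (law c).
Proof.
move=> [e1 [e2 [e3 [e4 [z1 [z2 [z3 z4]]]]]]].
pose V := ('rV[R]_m * 'rV[R]_m * R)%type.
have cont1 : continuous (fun p : V => (p.1.1, p.2)).
  move=> p; apply: (@cvg_pair _ _ _ (nbhs p) (nbhs p.1.1) (nbhs p.2)); last exact: cvg_snd.
  by apply: (@continuous_comp _ _ _ fst fst); apply: cvg_fst.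
have cont2 : continuous (fun p : V => (p.1.2, p.2)).
  move=> p; apply: (@cvg_pair _ _ _ (nbhs p) (nbhs p.1.2) (nbhs p.2)); last exact: cvg_snd.
  by apply: (@continuous_comp _ _ _ fst snd); [apply: cvg_fst|apply: cvg_snd].
have cont3 : continuous (fun p : V => p.2) by move=> p; apply: cvg_snd.
have lin1 : linear (fun p : V => (p.1.1, p.2)) by [].
have lin2 : linear (fun p : V => (p.1.2, p.2)) by [].
have lin3 : linear (fun p : V => p.2) by [].
pose p1 : {linear V -> ('rV[R]_m * R)%type} :=
  HB.pack (fun p : V => (p.1.1, p.2)) (GRing.isLinear.Build _ _ _ _ _ lin1).
pose p2 : {linear V -> ('rV[R]_m * R)%type} :=
  HB.pack (fun p : V => (p.1.2, p.2)) (GRing.isLinear.Build _ _ _ _ _ lin2).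
pose p3 : {linear V -> R} :=
  HB.pack (fun p : V => p.2) (GRing.isLinear.Build _ _ _ _ _ lin3).
case: c.
- exact: e1.
- exact: (C1_comp_linear _ _ _ _ p1 _ cont1 e2).
- exact: (C1_comp_linear _ _ _ _ p2 _ cont2 e3).
- exact: (C1_comp_linear _ _ _ _ p3 _ cont3 e4).
- exact: z1.
- exact: (C1_comp_linear _ _ _ _ p1 _ cont1 z2).
- exact: (C1_comp_linear _ _ _ _ p2 _ cont2 z3).
- exact: (C1_comp_linear _ _ _ _ p3 _ cont3 z4).
Qed.

Lemma law_local c z z' u u' t : devices_local cls dv ->
  (dynamic c -> agree_on cls c z z') -> (resistive c -> agree_on cls c u u') ->
  agree_on cls c (law c (z, u, t)) (law c (z', u', t)).
Proof.
move=> [l1 [l2 [l3 [l4 [l5 l6]]]]]; case: c => //= zz uu.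
- exact: l1 (zz isT) (uu isT).
- exact: l2 (zz isT).
- exact: l3 (uu isT).
- exact: l4 (zz isT) (uu isT).
- exact: l5 (zz isT).
- exact: l6 (uu isT).
Qed.

(** Stated for [p] rows so as to apply to states and to coefficient matrices alike. With the
    arguments swapped, [control i v] lists the controlled variables. *)
Definition control {p} (v i : 'M[R]_(p, m)) : 'M[R]_(p, m) :=
  \matrix_(k, j) if current_driven (cls j) then i k j else v k j.

Lemma mulmx_control p q (A : 'M[R]_(p, q)) (v i : 'M[R]_(q, m)) :
  A *m control v i = control (A *m v) (A *m i).
Proof.
by apply/matrixP => a j; rewrite !mxE; case: ifP => cj;
  apply: eq_bigr => k _; rewrite mxE cj.
Qed.

Lemma controlB p (v i v' i' : 'M[R]_(p, m)) :
  control (v - v') (i - i') = control v i - control v' i'.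
Proof. by apply/matrixP => a j; rewrite !mxE; case: ifP. Qed.

(** The eight device relations merge into one equation: by locality a law of class [c] reads the
    mixed vector [control v i] only on branches of class [c], where it is [i] or [v] itself. *)
Lemma consistentE rB rD (B : 'M[R]_(rB, m)) (D : 'M[R]_(rD, m)) t z v i :
  devices_local cls dv ->
  consistent cls B D dv t (z, v, i) <->
  [/\ forall j, control i v ord0 j = law (cls j) (z, control v i, t) ord0 j,
      B *m v^T = 0 & D *m i^T = 0].
Proof.
move=> dl; rewrite /consistent /=.
have E j : law (cls j) (z, control v i, t) ord0 j =
    law (cls j) (z, if current_driven (cls j) then i else v, t) ord0 j.
  by apply: law_local => // _ k kj; rewrite !mxE kj; case: ifP.
split=> [[dev [Bv Di]]|[dev Bv Di]]; split=> // j; move: (dev j);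
  by rewrite E mxE; case: (cls j).
Qed.

Section Incremental.
Context (dC1 : devices_C1 dv) (dloc : devices_local cls dv).

Lemma law_partial_differentiable c z t u :
  differentiable (fun u' => law c (z, u', t)) u.
Proof.
apply: (@differentiable_comp _ _ _ _ (fun u' => (z, u', t)) (law c)).
  apply: (@ex_diff _ _ _ _ _ _ _ (is_diff_pair
    (is_diff_pair (is_diff_cst z u) (is_diff_id u)) (is_diff_cst t u))).
by case: (law_C1 c dC1) => + _; apply.
Qed.

Lemma d_law_partial c z t u w j :
  'd (law c) (z, u, t) (0, w, 0) ord0 j = 'd (fun u' => law c (z, u', t)) u w ord0 j.
Proof.
apply: diff_line_eq => [||s]; first by case: (law_C1 c dC1) => + _; apply.
  exact: law_partial_differentiable.
congr (law c _ _ _).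
by rewrite -[(z, u, t) + _]/(z + s *: 0, u + s *: w, t + s *: 0) !scaler0 !addr0.
Qed.

Lemma d_law_nonresistive c z t u w j : ~~ resistive c -> cls j = c ->
  'd (fun u' => law c (z, u', t)) u w ord0 j = 0.
Proof.
move=> nrc cj; rewrite (@diff_line_eq _ _ _ _ _ (fun u' => law c (z, u', t)) u w u 0 j).
- by rewrite linear0 mxE.
- exact: law_partial_differentiable.
- exact: law_partial_differentiable.
- by move=> s; apply: law_local cj => // rc; rewrite rc in nrc.
Qed.

End Incremental.

End Laws.

Lemma uniform_radius (R : realDomainType) (I : finType) (P : I -> R -> Prop) :
  (forall i, exists2 d, 0 < d & P i d) ->
  (forall i d d', d' <= d -> P i d -> P i d') -> exists2 d, 0 < d & forall i, P i d.
Proof.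
move=> exd mono; have /choice [d dP] : forall i, exists d, 0 < d /\ P i d.
  by move=> i; have [d ? ?] := exd i; exists d.
exists (\big[Num.min/1]_i d i) => [|i].
  by apply/bigmin_gtP; split=> // i _; have [] := dP i.
by apply: mono (dP i).2; apply: bigmin_le.
Qed.

Lemma strict_diff_rV (R : realType) (V : normedModType R) m
    (f : 'I_m -> V -> 'rV[R]_m) x0 :
  findim V -> (forall j, C1 (f j)) ->
  forall e, 0 < e -> exists2 d, 0 < d & forall x x', `|x - x0| < d -> `|x' - x0| < d ->
    forall j, `|f j x ord0 j - f j x' ord0 j - 'd (f j) x0 (x - x') ord0 j| <= e * `|x - x'|.
Proof.
move=> fV fC e e0.
have [||d d0 dP] := @uniform_radius _ 'I_m (fun j d => forall x x', `|x - x0| < d ->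
    `|x' - x0| < d ->
    `|f j x ord0 j - f j x' ord0 j - 'd (f j) x0 (x - x') ord0 j| <= e * `|x - x'|).
- by move=> j; apply: (C1_strict_diff _ _ _ _ _ fV (fC j)).
- by move=> j d d' dd' H x x' xd xd'; apply: H; apply: lt_le_trans dd'.
by exists d => // x x' xd xd' j; apply: dP.
Qed.

Lemma diff_rV_bounded (R : realType) (V : normedModType R) m
    (f : 'I_m -> V -> 'rV[R]_m) x0 :
  (forall j, differentiable (f j) x0) ->
  exists2 C, 0 < C & forall j h, `|'d (f j) x0 h ord0 j| <= C * `|h|.
Proof.
move=> fd; have /choice [c cP] : forall j, exists c, 0 < c /\
    forall h, `|'d (f j) x0 h ord0 j| <= c * `|h|.
  move=> j; have [c c0 cP] := linear_lipschitz (diff_continuous (fd j)).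
  by exists c; split=> // h; apply: le_trans (cP h); apply: ler_coord_norm.
exists (1 + \sum_j c j) => [|j h].
  by rewrite ltr_pwDl // sumr_ge0 // => j _; rewrite ltW // (cP j).1.
apply: le_trans ((cP j).2 h) _; rewrite ler_wpM2r // (bigD1 j) //= addrCA lerDl.
by rewrite addr_ge0 // sumr_ge0 // => k _; rewrite ltW // (cP k).1.
Qed.

(** * Solvability of the circuit equations *)

Section Circuit.
Context {R : realType} {n m : nat} (tl hd : 'I_m -> 'I_n).
Context (cls : 'I_m -> dclass) {rB rD : nat} (B : 'M[R]_(rB, m)) (D : 'M[R]_(rD, m)).
Context (dv : devices R m).
Context (rlB : reduced_loop_matrix tl hd B) (rcD : reduced_cutset_matrix tl hd D).
Context (dC1 : devices_C1 dv) (dloc : devices_local cls dv).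
Context (noVC : forall L : {set 'I_m}, is_loop tl hd L ->
  ~ (forall j, j \in L -> cls j = VSrc \/ cls j = Cap)).
Context (noIL : forall K : {set 'I_m}, is_cutset tl hd K ->
  ~ (forall j, j \in K -> cls j = CSrc \/ cls j = Ind)).
Context (law_pos : forall c, resistive c -> forall z u t,
  posdef_on cls c ('d (fun u' => law dv c (z, u', t)) u)).

Let law_diff c z t u : differentiable (fun u' => law dv c (z, u', t)) u.
Proof. exact: law_partial_differentiable. Qed.

Let law_loc c z t u u' : agree_on cls c u u' ->
  agree_on cls c (law dv c (z, u, t)) (law dv c (z, u', t)).
Proof. by move=> uu'; apply: law_local. Qed.

Lemma controlled_zero (v i : 'rV[R]_m) (u := control cls v i) (o := control cls i v) :
  B *m v^T = 0 -> D *m i^T = 0 ->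
  (forall j, ~~ resistive (cls j) -> o ord0 j = 0) ->
  (forall c, resistive c -> (forall j, cls j = c -> u ord0 j = 0 /\ o ord0 j = 0) \/
     0 < \sum_(j < m | cls j == c) u ord0 j * o ord0 j) ->
  v = 0 /\ i = 0.
Proof.
move=> Bv Di o0 pos; apply: circuit_zero rlB rcD noVC noIL Bv Di _ _ _ => [j|j|c rc].
- by move=> cj; have := o0 j; rewrite mxE; case: cj => -> /(_ isT).
- by move=> cj; have := o0 j; rewrite mxE; case: cj => -> /(_ isT).
have [z|p] := pos c rc; [left=> j cj|right].
  by have := z j cj; rewrite !mxE; case: ifP => _ [].
rewrite (eq_bigr (fun j => u ord0 j * o ord0 j)) // => j _.
by rewrite !mxE; case: ifP => // _; rewrite mulrC.
Qed.

(** The difference of the two states obeys Kirchhoff's laws. With equal charges and fluxes,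
    nonresistive branches have equal outputs and resistive ones have monotone laws, so
    [controlled_zero] applies. *)
Lemma consistent_determined t z v i z' v' i' :
  consistent cls B D dv t (z, v, i) -> consistent cls B D dv t (z', v', i') ->
  (forall j, dynamic (cls j) -> z ord0 j = z' ord0 j) -> v = v' /\ i = i'.
Proof.
move=> /(consistentE _ _ _ _ _ _ _ _ _ _ dloc) [oE Bv Di].
move=> /(consistentE _ _ _ _ _ _ _ _ _ _ dloc) [oE' Bv' Di'] zz'.
have zloc c u : agree_on cls c (law dv c (z', u, t)) (law dv c (z, u, t)).
  by apply: law_local => // dc k ck; rewrite zz' // ck.
suff [/eqP v0 /eqP i0] : v - v' = 0 /\ i - i' = 0.
  by rewrite -[v](subrK v') -[i](subrK i') (eqP v0) (eqP i0) !add0r.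
have subE (M M' : 'rV[R]_m) j : (M - M') ord0 j = M ord0 j - M' ord0 j by rewrite !mxE.
apply: controlled_zero; rewrite ?linearB /= ?mulmxBr ?Bv ?Bv' ?Di ?Di' ?subrr //.
  move=> j nrj; rewrite controlB subE oE oE' (zloc _ _ j erefl).
  apply/eqP; rewrite subr_eq0; apply/eqP.
  by apply: (law_local cls dv (cls j)) => // rj; rewrite rj in nrj.
move=> c rc; set u := control cls v i; set u' := control cls v' i'.
pose f w := law dv c (z, w, t).
have uB : control cls (v - v') (i - i') = u - u' by rewrite controlB.
have oB j : cls j = c -> control cls (i - i') (v - v') ord0 j = (f u - f u') ord0 j.
  by move=> cj; rewrite controlB !subE oE oE' cj (zloc c u' j cj).
have [uu'|p] := posdef_monotone cls c f (law_diff c z t) (law_loc c z t)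
  (fun x => law_pos c rc z x t) u u'; [left=> j cj|right].
  by rewrite oB // uB !subE (uu' j cj) (law_loc c z t u u' uu' j cj) !subrr.
rewrite uB (eq_bigr (fun j => (u - u') ord0 j * (f u - f u') ord0 j)) // => j /eqP cj.
by rewrite oB.
Qed.

(* Kirchhoff's laws are solved by [v = a *m D] and [i = b *m B]; the row vector
   [(a, b)] is the algebraic unknown, with as many entries as branches. *)
Definition volt_mx : 'M[R]_(rD + rB, m) := col_mx D 0.
Definition curr_mx : 'M[R]_(rD + rB, m) := col_mx 0 B.
Definition control_mx := control cls volt_mx curr_mx.
Definition output_mx := control cls curr_mx volt_mx.

Lemma KVL_volt_mx y : B *m (y *m volt_mx : 'rV[R]_m)^T = 0.
Proof.
rewrite -[y]hsubmxK mul_row_col mulmx0 addr0 trmx_mul mulmxA.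
by rewrite (loop_cutset_orth _ _ rlB rcD) mul0mx.
Qed.

Lemma KCL_curr_mx y : D *m (y *m curr_mx : 'rV[R]_m)^T = 0.
Proof.
rewrite -[y]hsubmxK mul_row_col mulmx0 add0r trmx_mul mulmxA.
by rewrite -[D]trmxK -trmx_mul (loop_cutset_orth _ _ rlB rcD) trmx0 mul0mx.
Qed.

Lemma volt_curr_mx_eq0 (y : 'rV[R]_(rD + rB)) : y *m volt_mx = 0 -> y *m curr_mx = 0 -> y = 0.
Proof.
have Dfree : row_free D by case: rcD => _ rk _; rewrite /row_free rk.
have Bfree : row_free B by case: rlB => _ rk _; rewrite /row_free rk.
rewrite -[y]hsubmxK !mul_row_col !mulmx0 addr0 add0r => /eqP yD /eqP yB.
move: yD yB; rewrite !mulmx_free_eq0 // => /eqP -> /eqP ->.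
by rewrite row_mx0.
Qed.

Definition law_jacobian z u t : 'M[R]_m :=
  \matrix_(k, j) lin1_mx ('d (fun u' => law dv (cls j) (z, u', t)) u) k j.

Lemma mul_law_jacobian z u t (w : 'rV[R]_m) j :
  (w *m law_jacobian z u t) ord0 j = 'd (fun u' => law dv (cls j) (z, u', t)) u w ord0 j.
Proof.
by rewrite -mul_rV_lin1 !mxE; apply: eq_bigr => k _; rewrite [in LHS]mxE.
Qed.

(** Derivative in [y] of the defect in the device laws, with [y *m output_mx] as controlled and
    [y *m control_mx] as controlling variables. *)
Definition circuit_jacobian z u t : 'M[R]_(rD + rB, m) :=
  output_mx - control_mx *m law_jacobian z u t.

(** A left kernel vector is a state of the linearized circuit with charges, fluxes and time
    frozen. *)
Lemma circuit_jacobian_free z u t : row_free (circuit_jacobian z u t).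
Proof.
rewrite -kermx_eq0; apply/rowV0P => y /sub_kermxP.
rewrite mulmxBr mulmxA => /eqP; rewrite subr_eq0 !mulmx_control => /eqP oE.
suff [] : y *m volt_mx = 0 /\ y *m curr_mx = 0 by apply: volt_curr_mx_eq0.
apply: controlled_zero (KVL_volt_mx y) (KCL_curr_mx y) _ _ => [j nrj|c rc]; rewrite oE.
  by rewrite mul_law_jacobian; apply: (d_law_nonresistive cls).
set w := control _ _ _.
have [H|H] := posdef_dichotomy cls c (fun w => law dv c (z, w, t)) (law_diff c z t)
    (law_loc c z t) (fun x => law_pos c rc z x t) u w; [left=> j cj|right].
  by rewrite mul_law_jacobian cj; apply: H.
rewrite (eq_bigr (fun j => w ord0 j * 'd (fun w => law dv c (z, w, t)) u w ord0 j)) //.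
by move=> j /eqP cj; rewrite mul_law_jacobian cj.
Qed.

Lemma circuit_jacobian_inverse z u t (L := circuit_jacobian z u t) :
  exists K, L *m K = 1%:M /\ K *m L = 1%:M.
Proof.
exists (pinvmx L); split; first exact/mulmxVp/circuit_jacobian_free.
apply: mulVpmx; rewrite /row_full (eqP (circuit_jacobian_free z u t)).
by rewrite addnC (loop_cutset_rank _ _ rlB rcD).
Qed.


Lemma implicit_state t0 z0 v0 i0 : consistent cls B D dv t0 (z0, v0, i0) ->
  exists (Y : 'rV[R]_m * R -> 'rV[R]_(rD + rB)) (d c : R), [/\ 0 < d, 0 < c,
    forall x, `|x - (z0, t0)| <= d ->
      consistent cls B D dv x.2 (x.1, Y x *m volt_mx, Y x *m curr_mx) &
    forall x x', `|x - (z0, t0)| <= d -> `|x' - (z0, t0)| <= d ->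
      `|Y x - Y x'| <= c * `|x - x'|].
Proof.
move=> /(consistentE _ _ _ _ _ _ _ _ _ _ dloc) [oE Bv Di].
have [a va] := KVL_mulmx _ _ rlB rcD v0 Bv.
have [b ib] := KCL_mulmx _ _ rlB rcD i0 Di.
pose y0 := row_mx a b.
have yv : y0 *m volt_mx = v0 by rewrite mul_row_col mulmx0 addr0.
have yi : y0 *m curr_mx = i0 by rewrite mul_row_col mulmx0 add0r.
pose u0 := y0 *m control_mx.
pose V := ('rV[R]_m * 'rV[R]_m * R)%type; pose p0 : V := (z0, u0, t0).
pose f j := law dv (cls j).
pose P (x : 'rV[R]_m * R) (y : 'rV[R]_(rD + rB)) : V := (x.1, y *m control_mx, x.2).
pose Psi x y := y *m output_mx - \row_j f j (P x y) ord0 j.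
have fC1 j : C1 (f j) by apply: law_C1.
have Vfin : findim V by apply: findim_prod; [apply: findim_prod|apply: findim_R];
  apply: findim_rV.
have [K [LK KL]] := circuit_jacobian_inverse z0 u0 t0.
have [cU cU0 cUP] := mulmx_bounded _ _ _ control_mx.
have [C C0 CP] := @diff_rV_bounded _ V _ f p0 (fun j => (fC1 j).1 p0).
have P_near d : 0 < d -> exists2 d', 0 < d' & forall x y,
    `|x - (z0, t0)| < d' -> `|y - y0| < d' -> `|P x y - p0| < d.
  move=> d0'; exists (Num.min d (d / cU)); first by rewrite lt_min d0' divr_gt0.
  move=> [z t] y; rewrite !prod_normE /= !lt_min !gt_max.
  move=> /andP [/andP [zd td] _] /andP [_ yd]; rewrite zd td /= andbT.
  by rewrite -mulmxBl; apply: le_lt_trans (cUP _) _; rewrite mulrC -ltr_pdivlMr.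
have PB_x x x' y : `|P x y - P x' y| = `|x - x'|.
  by rewrite !prod_normE /= subrr normr0 (max_l (normr_ge0 _)).
have PB_y x y y' : P x y - P x y' = (0, (y - y') *m control_mx, 0).
  by rewrite mulmxBl; congr (_, _, _); rewrite /= subrr.
have subE (M M' : 'rV[R]_m) j : (M - M') ord0 j = M ord0 j - M' ord0 j by rewrite !mxE.
have PsiE x y j : Psi x y ord0 j = (y *m output_mx) ord0 j - f j (P x y) ord0 j.
  by rewrite /Psi subE [X in _ - X]mxE.
clearbody Psi.
have Psi0 : Psi (z0, t0) y0 = 0.
  apply/rowP => j; rewrite PsiE [RHS]mxE mulmx_control yv yi oE.
  by rewrite /f /P /u0 mulmx_control yv yi subrr.
(* Error 1 suffices for the Lipschitz bound in [x]: with [C] bounding the derivative at [p0] it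
   gives the constant [C + 1]. *)
have [d1 d10 fd1] := strict_diff_rV _ _ _ f p0 Vfin fC1 1 ltr01.
have [d2 d20 Pd2] := P_near d1 d10.
have [||||Y [d [c [d0' c0 YP Ylip]]]] := lipschitz_implicit_function R _ _ _ Psi _ K
    (z0, t0) y0 (C + 1) d2 LK KL Psi0.
- by rewrite addr_gt0.
- by [].
- move=> e e0; have ecU : 0 < e / cU by rewrite divr_gt0.
  have [d3 d30 fd3] := strict_diff_rV _ _ _ f p0 Vfin fC1 _ ecU.
  have [d4 d40 Pd4] := P_near d3 d30; exists d4 => // x y y' xd yd yd'.
  apply: rV_norm_le => [|j]; first by rewrite mulr_ge0 // ltW.
  have := fd3 _ _ (Pd4 x y xd yd) (Pd4 x y' xd yd') j.
  rewrite PB_y d_law_partial // -mul_law_jacobian => H.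
  rewrite /circuit_jacobian mulmxBr mulmxA !subE !PsiE mulmxBl subE.
  set a1 := (y *m output_mx) ord0 j in H *; set a2 := (y' *m output_mx) ord0 j in H *.
  set b1 := f j _ _ _ in H *; set b2 := f j _ _ _ in H *; set b3 := (_ *m _) ord0 j in H *.
  have -> : a1 - b1 - (a2 - b2) - (a1 - a2 - b3) = - (b1 - b2 - b3) by ring.
  rewrite normrN; apply: le_trans H _; rewrite -mulrA ler_pM2l // ler_pdivrMl //.
  by rewrite !prod_normE /= !normr0 (max_r (normr_ge0 _)) (max_l (normr_ge0 _)).
- move=> x x' y xd xd' yd; apply: rV_norm_le => [|j].
    by rewrite mulr_ge0 // addr_ge0 // ltW.
  have := fd1 _ _ (Pd2 _ _ xd yd) (Pd2 _ _ xd' yd) j; rewrite mul1r PB_x => H.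
  have := CP j (P x y - P x' y); rewrite PB_x => H'.
  rewrite subE !PsiE; set a1 := (y *m _) ord0 j.
  set l := 'd (f j) p0 _ ord0 j in H H' *.
  set b1 := f j _ _ _ in H *; set b2 := f j _ _ _ in H *.
  have -> : a1 - b1 - (a1 - b2) = - (l + (b1 - b2 - l)) by ring.
  by rewrite normrN mulrDl mul1r; apply: le_trans (ler_normD _ _) _; apply: lerD.
exists Y, d, c; split=> // x xd.
apply/(consistentE _ _ _ _ _ _ _ _ _ _ dloc); split=> [j||]; [|exact: KVL_volt_mx|exact: KCL_curr_mx].
have /rowP/(_ j) := YP x xd; rewrite PsiE [RHS]mxE => /eqP.
by rewrite subr_eq0 mulmx_control /f /P mulmx_control => /eqP.
Qed.

Lemma local_solutions t0 z0 v0 i0 : consistent cls B D dv t0 (z0, v0, i0) ->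
  exists2 eps, 0 < eps & forall a : 'rV[R]_m, `|a - z0| <= eps ->
    exists (d : R) (sol : R -> cstate R m), [/\ 0 < d,
      is_solution cls B D dv (t0 - d) (t0 + d) sol & (sol t0).1.1 = a].
Proof.
move=> /implicit_state [Y [r [c [r0 c0 Ycons Ylip]]]].
have [cU cU0 cUP] := mulmx_bounded _ _ _ control_mx.
(* Charges integrate currents and fluxes integrate voltages, so the right-hand side is the
   controlling variable. Padding coordinates are integrated along with the others. *)
pose f z t := Y (z, t) *m control_mx.
have [|d d0 sol] := picard_lindelof _ f z0 t0 r (cU * c) r0 (mulr_gt0 cU0 c0).
  move=> z z' t t' zr zr' tr tr'; rewrite /f -mulmxBl; apply: le_trans (cUP _) _.
  rewrite -mulrA ler_pM2l //; apply: le_trans (Ylip _ _ _ _) _;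
    rewrite ?prod_normE ?ge_max /= ?zr ?zr' //.
  by rewrite ler_pM2l // ge_max lerDl lerDr !normr_ge0.
exists (r / 2); first by rewrite divr_gt0.
(* The bound [r] on time keeps [(w t, t)] in the domain where [Y] solves the circuit equations. *)
move=> a /sol [w [w0 wP]]; exists (Num.min d r).
pose y t := Y (w t, t); exists (fun t => (w t, y t *m volt_mx, y t *m curr_mx)).
split=> //; first by rewrite lt_min d0.
move=> t tint; have : `|t - t0| < Num.min d r by rewrite ltr_distl.
rewrite lt_min => /andP [td tr]; have [wr dw] := wP t td; split.
  by apply: (Ycons (w t, t)); rewrite prod_normE ge_max /= wr ltW.
move=> j jdyn; have := dw j; rewrite /f mulmx_control mxE /=.
by case: (cls j) jdyn.
Qed.

End Circuit.

Local Close Scope classical_set_scope.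

Theorem theorem1 (R : realType) (n m : nat) (tl hd : 'I_m -> 'I_n)
  (cls : 'I_m -> dclass) (rB rD : nat) (B : 'M[R]_(rB, m)) (D : 'M[R]_(rD, m))
  (dv : devices R m) :
  reduced_loop_matrix tl hd B ->
  reduced_cutset_matrix tl hd D ->
  devices_C1 dv ->
  devices_local cls dv ->
  memristor_model cls dv ->
  (* no VC-loop *)
  (forall L : {set 'I_m}, is_loop tl hd L ->
     ~ (forall j, j \in L -> cls j = VSrc \/ cls j = Cap)) ->
  (* no IL-cutset *)
  (forall K : {set 'I_m}, is_cutset tl hd K ->
     ~ (forall j, j \in K -> cls j = CSrc \/ cls j = Ind)) ->
  (* M, R, W, G positive definite at every point *)
  (forall q i t, posdef_on cls QMem ('d (fun i' => eta1 dv q i' t) i)) ->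
  (forall i t, posdef_on cls CRes ('d (fun i' => eta3 dv i' t) i)) ->
  (forall p v t, posdef_on cls PMem ('d (fun v' => zeta1 dv p v' t) v)) ->
  (forall v t, posdef_on cls VRes ('d (fun v' => zeta3 dv v' t) v)) ->
  order_of_complexity cls B D dv
    #|[set j | (cls j == QMem) || (cls j == PMem) || (cls j == Cap) || (cls j == Ind)]|.
Proof.
move=> rlB rcD dC1 dloc _ noVC noIL Mpos Rpos Wpos Gpos t0 [[z0 v0] i0] cons0.
have law_pos c : resistive c -> forall z u t,
    posdef_on cls c ('d (fun u' => law dv c (z, u', t)) u).
  case: c => rc z u t; try discriminate rc.
  - exact (Mpos z u t).
  - exact (Rpos u t).
  - exact (Wpos z u t).
  - exact (Gpos u t).
pose J := [set x : cvar m | (x.1 == 0 :> nat) && dynamic (cls x.2)].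
have [eps eps0 free] :=
  local_solutions tl hd cls B D dv rlB rcD dC1 dloc noVC noIL law_pos t0 z0 v0 i0 cons0.
exists J, eps; split=> //.
- by apply/fintype.subsetP => x; rewrite inE => /andP [_ dx]; apply/orP; right.
- rewrite -(card_imset _ (f := fun j => (ord0, j) : cvar m)); last by move=> ? ? [].
  apply: eq_card => -[k j]; rewrite !inE /=; apply/andP/imsetP => [[/eqP k0 dj]|[j' + [-> ->]]].
    exists j; last by congr pair; apply/val_inj.
    by rewrite inE; case: (cls j) dj.
  by rewrite inE; case: (cls j').
- move=> a aJ.
  (* Padding coordinates are taken from [z0], so that [za] is close to [z0] in every coordinate. *)
  pose za : 'rV[R]_m := \row_j (if dynamic (cls j) then a (ord0, j) else z0 ord0 j).
  have [|d [sol [d0 solP solE]]] := free za.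
    apply: rV_norm_le => [|j]; first exact: ltW.
    rewrite !mxE; case: ifP => dj; last by rewrite subrr normr0 ltW.
    by apply/ltW/(aJ (ord0, j)); rewrite inE /= dj.
  exists d, sol; split=> //; split=> // -[k j]; rewrite inE /= => /andP [/eqP k0 dj].
  rewrite /var_val /= k0 eqxx solE mxE dj; congr (a (_, _)).
  exact/val_inj.
move=> [[z1 v1] i1] [[z2 v2] i2] cons1 cons2 _ _ agreeJ.
have z12 j : dynamic (cls j) -> z1 ord0 j = z2 ord0 j.
  by move=> dj; apply: (agreeJ (ord0, j)); rewrite inE.
have [v12 i12] := consistent_determined tl hd cls B D dv rlB rcD dC1 dloc
  noVC noIL law_pos t0 z1 v1 i1 z2 v2 i2 cons1 cons2 z12.
move=> [k j]; rewrite /valid_var /var_val /= v12 i12.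
by case: ifP => // _ /= dj; apply: z12.
Qed.
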